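(* Let $\Omega$ be a countable (possibly finite) set of cardinality at least three, and let $F \lneq F' \leq \mathrm{Sym}(\Omega)$ be countable permutation groups such that $F$ acts freely on $\Omega$, $F'$ preserves the orbits of $F$, and for every $a \in \Omega$ the point stabilizer $F'_a$ is amenable. Then the group $G(F,F')$ is countable, has trivial amenable radical and is not $C^\ast$-simple.
   Context: All groups are regarded as discrete groups; in particular amenability and $C^\ast$-simplicity always refer to the discrete topology. A countable group $G$ is $C^\ast$-simple if its reduced $C^\ast$-algebra (the operator norm closure of the group algebra $\mathbf{C}[G]$ acting on $\ell^2(G)$ by the left-regular representation) has no non-trivial two-sided closed ideal. The amenable radical of a group is its largest amenable normal subgroup. $F$ acts freely on $\Omega$ if all point stabilizers in $F$ are trivial; $F'$ preserves the orbits of $F$ if every $F$-orbit in $\Omega$ is $F'$-invariant. Let $T_\Omega$ be the regular tree of degree $|\Omega|$. Fix a coloring of the edges $c : E(T_\Omega) \rightarrow \Omega$ such that for every vertex $v$, the restriction of $c$ to the set of edges containing $v$ is a bijection onto $\Omega$. For $g \in \mathrm{Aut}(T_\Omega)$ and a vertex $v$, the action of $g$ from the edges around $v$ to the edges around $g(v)$ gives, after identifying both sets of edges with $\Omega$ via $c$, a permutation $\sigma(g,v) \in \mathrm{Sym}(\Omega)$. For $F \leq F' \leq \mathrm{Sym}(\Omega)$, $G(F,F')$ is the group of all $g \in \mathrm{Aut}(T_\Omega)$ such that $\sigma(g,v) \in F'$ for all vertices $v$ and $\sigma(g,v) \in F$ for all but finitely many vertices $v$. *)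

(* Defs.v *)
From HB Require Import structures.
From mathcomp Require Import all_boot all_order all_algebra.
From mathcomp Require Import all_classical all_reals all_analysis.
From mathcomp Require Import complex ring.

Set Implicit Arguments.
Unset Strict Implicit.
Unset Printing Implicit Defensive.

Import Order.TTheory GRing.Theory Num.Theory.
Import numFieldNormedType.Exports.
Import ComplexField.Normc.

Local Open Scope classical_set_scope.
Local Open Scope ring_scope.

(* A discrete group is a [groupType]; a subgroup of [G] is a [groupClosed G],
   and [group_of H] is the subgroup [H] as a group in its own right. *)
Section Subgroups.
Variable G : groupType.
Implicit Types H : groupClosed G.

Record group_of H : Type := GroupOf { group_val :> G; _ : group_val \in H }.

Lemma group_of_closed H : group_closed (fun x : G => x \in H).
Proof.
by split=> [|x y xH yH]; rewrite -?topredE /= ?gpred1 ?gpredM ?gpredVr.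
Qed.

HB.instance Definition _ H := [isSub for @group_val H].
HB.instance Definition _ H := [Choice of group_of H by <:].
HB.instance Definition _ H :=
  SubChoice_isSubGroup.Build G _ (group_of H) (group_of_closed H).

Definition trivial_subgroup : {pred G} := pred1 1%g.

Lemma trivial_subgroupM : mulg_closed trivial_subgroup.
Proof. by move=> x y /eqP-> /eqP->; rewrite mulg1 inE. Qed.
Lemma trivial_subgroup1 : 1%g \in trivial_subgroup.
Proof. by rewrite inE. Qed.
Lemma trivial_subgroupV : invg_closed trivial_subgroup.
Proof. by move=> x /eqP->; rewrite invg1 inE. Qed.

HB.instance Definition _ :=
  isMulClosed.Build G trivial_subgroup trivial_subgroupM.
HB.instance Definition _ :=
  isMul1Closed.Build G trivial_subgroup trivial_subgroup1.
HB.instance Definition _ :=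
  isInvClosed.Build G trivial_subgroup trivial_subgroupV.

Definition is_normal H := forall x y : G, x \in H -> (x ^ y)%g \in H.

End Subgroups.
Arguments trivial_subgroup : clear implicits.

Section Amenability.
Variables (R : realType) (G : groupType).

(* Only the values of [m] on bounded functions are constrained. *)
Record left_invariant_mean (m : (G -> R) -> R) : Prop := {
  meanD : forall f h : G -> R, bounded_fun f -> bounded_fun h ->
    m (fun x => f x + h x) = m f + m h;
  meanZ : forall (a : R) (f : G -> R), bounded_fun f ->
    m (fun x => a * f x) = a * m f;
  mean_ge0 : forall f : G -> R, bounded_fun f ->
    (forall x, 0 <= f x) -> 0 <= m f;
  mean1 : m (fun=> 1) = 1;
  mean_invariant : forall (g : G) (f : G -> R), bounded_fun f ->
    m (fun x => f (g * x)%g) = m f }.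

Definition amenable := exists m, left_invariant_mean m.

End Amenability.

Definition is_amenable_radical (R : realType) (G : groupType)
    (N : groupClosed G) :=
  [/\ is_normal N, amenable R (group_of N)
    & forall M : groupClosed G, is_normal M -> amenable R (group_of M) ->
        {subset M <= N}].

Definition has_trivial_amenable_radical (R : realType) (G : groupType) :=
  is_amenable_radical R (trivial_subgroup G).

Section ReducedCstarAlgebra.
Variables (R : realType) (G : groupType).

Definition sqnorm (f : G -> R[i]^o) : \bar R :=
  (\esum_(x in [set: G]) (normc (f x) ^+ 2)%:E)%E.

Definition square_summable : {pred G -> R[i]^o} :=
  [pred f | `[< (sqnorm f < +oo)%E >]].

Lemma square_summable_scale (b : R) (f : G -> R[i]^o) :
  0 <= b -> (sqnorm f < +oo)%E ->
  (\esum_(x in [set: G]) (b%:E * (normc (f x) ^+ 2)%:E) < +oo)%E.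
Proof.
move=> b0 fs.
have f0 : (0 <= sqnorm f)%E by apply: esum_ge0 => x _; rewrite lee_fin sqr_ge0.
have [M fM] : exists M, sqnorm f = M%:E.
  by exists (fine (sqnorm f)); rewrite fineK// ge0_fin_numE.
apply: (@le_lt_trans _ _ (b * M)%:E); last by rewrite ltry.
apply: ge_ereal_sup => _ [X [finX XG] <-].
rewrite -ge0_mule_fsumr => [|x]; last by rewrite lee_fin sqr_ge0.
by rewrite EFinM -fM lee_wpmul2l ?lee_fin//; apply: ereal_sup_ubound; exists X.
Qed.

Lemma square_summable_submod : submod_closed square_summable.
Proof.
split.
  apply/asboolP; rewrite /sqnorm esum1// => x _.
  by rewrite -[X in normc X]/0%C normc0 expr0n.
move=> a f g /asboolP fs /asboolP gs; apply/asboolP; rewrite /sqnorm.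
apply: (@le_lt_trans _ _ (\esum_(x in [set: G])
    ((2 * normc a ^+ 2)%:E * (normc (f x) ^+ 2)%:E
     + 2%:E * (normc (g x) ^+ 2)%:E))%E).
  apply: le_esum => x _; rewrite -!EFinM -EFinD lee_fin.
  have n0 (z : R[i]) : 0 <= normc z by case: z => u v; exact: sqrtr_ge0.
  have le1 : normc (a * f x + g x) <= normc a * normc (f x) + normc (g x).
    by rewrite -normcM; exact: le_normcD.
  apply: (@le_trans _ _ ((normc a * normc (f x) + normc (g x)) ^+ 2)).
    by rewrite ler_sqr ?nnegrE ?addr_ge0 ?mulr_ge0.
  rewrite -subr_ge0.
  have -> : 2 * normc a ^+ 2 * normc (f x) ^+ 2 + 2 * normc (g x) ^+ 2
      - (normc a * normc (f x) + normc (g x)) ^+ 2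
    = (normc a * normc (f x) - normc (g x)) ^+ 2 by ring.
  exact: sqr_ge0.
rewrite esumD => [|x _|x _].
- apply: lte_add_pinfty; apply: square_summable_scale => //.
  by rewrite mulr_ge0// sqr_ge0.
- by rewrite -EFinM lee_fin mulr_ge0 ?sqr_ge0// mulr_ge0// sqr_ge0.
- by rewrite -EFinM lee_fin mulr_ge0// sqr_ge0.
Qed.

HB.instance Definition _ :=
  GRing.isSubmodClosed.Build _ _ square_summable square_summable_submod.

Record l2 := L2 { l2_val :> G -> R[i]^o; _ : l2_val \in square_summable }.

HB.instance Definition _ := [isSub for l2_val].
HB.instance Definition _ := [Choice of l2 by <:].
HB.instance Definition _ := [SubChoice_isSubLmodule of l2 by <:].

Definition l2norm (xi : l2) : R := Num.sqrt (fine (sqnorm xi)).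

Lemma left_regular_subproof (g : G) (xi : l2) :
  (fun x => xi (g^-1 * x)%g) \in square_summable.
Proof.
case: xi => f /= /asboolP fs; apply/asboolP; move: fs; rewrite /sqnorm.
rewrite (@reindex_esum R G G setT setT (fun x : G => (g^-1 * x)%g))//.
- split=> // [x y _ _ /mulgI//|x _]; exists (g * x)%g => //.
  by rewrite mulKg.
Qed.

Definition left_regular (g : G) (xi : l2) : l2 :=
  L2 (left_regular_subproof g xi).

(* Operators are functions [l2 -> l2]: the linear structure is pointwise and the
   product is composition. *)
Implicit Types A B : l2 -> l2.

Definition opnorm A : \bar R :=
  ereal_sup [set (l2norm (A xi))%:E | xi in [set xi | l2norm xi <= 1]].

Definition bounded_operator A := linear A /\ (opnorm A < +oo)%E.

Definition norm_closure (S : set (l2 -> l2)) : set (l2 -> l2) :=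
  [set A | bounded_operator A /\
    forall e : R, 0 < e -> exists2 B, S B & (opnorm (A - B)%R < e%:E)%E].

(* The image of the group algebra in the left-regular representation, each of
   its elements being given as a finite formal combination of elements of [G]. *)
Definition group_algebra : set (l2 -> l2) :=
  [set A | exists s : seq (R[i] * G),
    A = \sum_(p <- s) p.1 *: left_regular p.2].

Definition reduced_Cstar_algebra : set (l2 -> l2) :=
  norm_closure group_algebra.

Record closed_two_sided_ideal (I : set (l2 -> l2)) : Prop := {
  ideal_sub : I `<=` reduced_Cstar_algebra;
  ideal0 : I 0;
  idealD : forall A B, I A -> I B -> I (A + B);
  idealZ : forall (a : R[i]) A, I A -> I (a *: A);
  ideal_mull : forall A B, reduced_Cstar_algebra A -> I B -> I (A \o B);
  ideal_mulr : forall A B, I A -> reduced_Cstar_algebra B -> I (A \o B);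
  ideal_closed : norm_closure I `<=` I }.

Definition Cstar_simple := forall I : set (l2 -> l2),
  closed_two_sided_ideal I -> I = [set 0] \/ I = reduced_Cstar_algebra.

End ReducedCstarAlgebra.

(* Permutations compose as functions: [(s * t) a = s (t a)]. *)
Section SymmetricGroup.
Variable T : choiceType.

Record sym := SymPerm { sym_fun :> T -> T; _ : `[< bijective sym_fun >] }.

HB.instance Definition _ := [isSub for sym_fun].
HB.instance Definition _ := [Choice of sym by <:].

Lemma sym_bij (s : sym) : bijective s.
Proof. by case: s => f /= /asboolP. Qed.

Lemma symP (s t : sym) : s =1 t -> s = t.
Proof. by move=> st; apply/val_inj/funext. Qed.

Definition to_sym (f : T -> T) (fbij : bijective f) : sym :=
  SymPerm (introT (asboolP _) fbij).

Lemma sym_inverse (s : sym) : exists t : T -> T, cancel s t /\ cancel t s.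
Proof. by case: (sym_bij s) => t sK tK; exists t. Qed.

Definition sym_inv_fun (s : sym) : T -> T := projT1 (cid (sym_inverse s)).

Lemma sym_funK s : cancel (sym_fun s) (sym_inv_fun s).
Proof. by rewrite /sym_inv_fun; case: cid => t []. Qed.
Lemma sym_inv_funK s : cancel (sym_inv_fun s) (sym_fun s).
Proof. by rewrite /sym_inv_fun; case: cid => t []. Qed.

Definition sym_one : sym := to_sym (inv_bij (fun x => erefl) : bijective id).
Definition sym_inv (s : sym) : sym :=
  to_sym (Bijective (sym_inv_funK s) (sym_funK s)).
Definition sym_mul (s t : sym) : sym :=
  to_sym (bij_comp (sym_bij s) (sym_bij t)).

Lemma sym_mulA : associative sym_mul. Proof. by move=> *; apply: symP. Qed.
Lemma sym_mul1 : left_id sym_one sym_mul. Proof. by move=> *; apply: symP. Qed.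
Lemma sym_1mul : right_id sym_one sym_mul. Proof. by move=> *; apply: symP. Qed.
Lemma sym_mulV : left_inverse sym_one sym_inv sym_mul.
Proof. by move=> s; apply: symP => a /=; rewrite sym_funK. Qed.
Lemma sym_Vmul : right_inverse sym_one sym_inv sym_mul.
Proof. by move=> s; apply: symP => a /=; rewrite sym_inv_funK. Qed.

HB.instance Definition _ :=
  isGroup.Build sym sym_mulA sym_mul1 sym_1mul sym_mulV sym_Vmul.

Lemma symM (s t : sym) a : (s * t)%g a = s (t a). Proof. by []. Qed.
Lemma symK (s : sym) : cancel s (s^-1)%g. Proof. exact: sym_funK. Qed.
Lemma symVK (s : sym) : cancel (s^-1)%g s. Proof. exact: sym_inv_funK. Qed.

Variable F : groupClosed sym.

Definition stabilizer (a : T) : {pred sym} := [pred s | (s \in F) && (s a == a)].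

Lemma stabilizerM a : mulg_closed (stabilizer a).
Proof.
move=> s t /andP[sF /eqP sa] /andP[tF /eqP ta].
by rewrite inE gpredM// symM ta sa eqxx.
Qed.
Lemma stabilizer1 a : 1%g \in stabilizer a.
Proof. by rewrite inE gpred1 eqxx. Qed.
Lemma stabilizerV a : invg_closed (stabilizer a).
Proof.
move=> s /andP[sF /eqP sa]; apply/andP; split; first by rewrite gpredVr.
by apply/eqP; rewrite -[RHS](symK s) sa.
Qed.

HB.instance Definition _ a :=
  isMulClosed.Build sym (stabilizer a) (@stabilizerM a).
HB.instance Definition _ a :=
  isMul1Closed.Build sym (stabilizer a) (stabilizer1 a).
HB.instance Definition _ a :=
  isInvClosed.Build sym (stabilizer a) (@stabilizerV a).

Definition acts_freely := forall a, stabilizer a =i trivial_subgroup sym.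

Definition orbit_of (a : T) : set T := [set s a | s in [set` F]].

Definition preserves_orbits (F' : groupClosed sym) :=
  forall s, s \in F' -> forall a b, orbit_of a b -> orbit_of a (s b).

End SymmetricGroup.

Record tree := Tree {
  vertex :> choiceType;
  adj : rel vertex;
  adj_sym : symmetric adj;
  adj_irr : irreflexive adj;
  tree_inhabited : inhabited vertex;
  tree_connected : forall v w, exists2 p, path adj v p & last v p = w;
  tree_acyclic : forall p, ucycle adj p -> (size p <= 2)%N }.

Definition regular_of_degree (T : tree) (Omega : Type) :=
  forall v : T, ([set w | adj v w] #= [set: Omega])%card.

(* [color v w] is the colour of the edge {v, w}; its value is irrelevant when
   [v] and [w] are not adjacent. *)
Record edge_coloring (T : tree) (Omega : Type) := EdgeColoring {
  color :> T -> T -> Omega;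
  color_sym : forall v w, adj v w -> color v w = color w v;
  color_bij : forall v, set_bij [set w | adj v w] [set: Omega] (color v) }.

Section Automorphisms.
Variable T : tree.

Definition automorphism : {pred sym T} :=
  [pred g : sym T | `[< {mono g : v w / adj v w} >]].

Lemma automorphismM : mulg_closed automorphism.
Proof.
by move=> g h /asboolP gA /asboolP hA; apply/asboolP => v w; rewrite gA hA.
Qed.
Lemma automorphism1 : 1%g \in automorphism. Proof. exact/asboolP. Qed.
Lemma automorphismV : invg_closed automorphism.
Proof.
by move=> g /asboolP gA; apply/asboolP => v w; rewrite -gA !symVK.
Qed.

HB.instance Definition _ :=
  isMulClosed.Build (sym T) automorphism automorphismM.
HB.instance Definition _ :=
  isMul1Closed.Build (sym T) automorphism automorphism1.
HB.instance Definition _ :=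
  isInvClosed.Build (sym T) automorphism automorphismV.

Record Aut := AutSym { aut_sym :> sym T; _ : aut_sym \in automorphism }.

HB.instance Definition _ := [isSub for aut_sym].
HB.instance Definition _ := [Choice of Aut by <:].
HB.instance Definition _ :=
  SubChoice_isSubGroup.Build (sym T) _ Aut (group_of_closed automorphism).

End Automorphisms.

Section LocalAction.
Variables (T : tree) (Omega : choiceType) (c : edge_coloring T Omega).
Implicit Types (g h : Aut T) (v w : T) (a : Omega).

Lemma autP g v w : adj (g v) (g w) = adj v w.
Proof. by case: g => g /= /asboolP gA; exact: gA. Qed.

Lemma neighbor_exists v a : exists w, adj v w /\ c v w = a.
Proof. by have [_ _ /(_ a I)[w vw <-]] := color_bij c v; exists w. Qed.

(* The other end of the edge of colour [a] at [v]. *)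
Definition neighbor v a : T := projT1 (cid (neighbor_exists v a)).

Lemma adj_neighbor v a : adj v (neighbor v a).
Proof. by rewrite /neighbor; case: cid => w []. Qed.
Lemma color_neighbor v a : c v (neighbor v a) = a.
Proof. by rewrite /neighbor; case: cid => w []. Qed.
Lemma neighbor_color v w : adj v w -> neighbor v (c v w) = w.
Proof.
move=> vw; have [_ cinj _] := color_bij c v.
by apply: cinj; rewrite ?inE ?color_neighbor//; exact: adj_neighbor.
Qed.

Lemma local_action_bij g v : bijective (fun a => c (g v) (g (neighbor v a))).
Proof.
have gV : (g^-1)%g (g v) = v by exact: symK.
exists (fun b => c v ((g^-1)%g (neighbor (g v) b))) => [a|b].
- by rewrite neighbor_color ?autP ?adj_neighbor// symK color_neighbor.
- rewrite neighbor_color; last by rewrite -(autP g) symVK adj_neighbor.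
  by rewrite symVK color_neighbor.
Qed.

(* The permutation sigma(g, v) of the colours induced by [g] from the edges at
   [v] to the edges at [g v]. *)
Definition local_action g v : sym Omega := to_sym (local_action_bij g v).

Lemma local_action_color g v w :
  adj v w -> local_action g v (c v w) = c (g v) (g w).
Proof. by move=> vw /=; rewrite neighbor_color. Qed.

Lemma local_action1 v : local_action 1%g v = 1%g.
Proof. by apply: symP => a /=; rewrite color_neighbor. Qed.

Lemma local_actionM g h v :
  local_action (g * h)%g v = (local_action g (h v) * local_action h v)%g.
Proof.
by apply: symP => a /=; rewrite neighbor_color// autP adj_neighbor.
Qed.

Lemma local_actionV g v :
  local_action (g^-1)%g v = ((local_action g ((g^-1)%g v))^-1)%g.
Proof.
apply: (mulgI (local_action g ((g^-1)%g v))).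
by rewrite -local_actionM !mulgV local_action1.
Qed.

Variables F F' : groupClosed (sym Omega).

Definition GFF : {pred Aut T} :=
  [pred g : Aut T | `[< (forall v, local_action g v \in F') /\
                        finite_set [set v | local_action g v \notin F] >]].

Lemma GFFM : mulg_closed GFF.
Proof.
move=> g h /asboolP[gF' gF] /asboolP[hF' hF]; apply/asboolP; split=> [v|].
  by rewrite local_actionM gpredM.
have fin : finite_set ([set v | local_action h v \notin F] `|`
    ((h^-1)%g : T -> T) @` [set v | local_action g v \notin F]).
  by rewrite finite_setU; split=> //; exact: finite_image.
apply: sub_finite_set fin => v /= vF.
have [hvF|hvF] := boolP (local_action h v \in F); last by left.
right; exists (h v); last exact: symK.
by apply: contra vF => gvF; rewrite local_actionM gpredM.
Qed.
Lemma GFF1 : 1%g \in GFF.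
Proof.
apply/asboolP; split=> [v|]; first by rewrite local_action1 gpred1.
rewrite (_ : [set _ | _] = set0)// -subset0 => v /=.
by rewrite local_action1 gpred1.
Qed.
Lemma GFFV : invg_closed GFF.
Proof.
move=> g /asboolP[gF' gF]; apply/asboolP; split=> [v|].
  by rewrite local_actionV gpredVr.
apply: sub_finite_set (finite_image (g : T -> T) gF) => v /=.
rewrite local_actionV => vF; exists ((g^-1)%g v); last exact: symVK.
by apply: contra vF => ?; rewrite gpredVr.
Qed.

HB.instance Definition _ := isMulClosed.Build (Aut T) GFF GFFM.
HB.instance Definition _ := isMul1Closed.Build (Aut T) GFF GFF1.
HB.instance Definition _ := isInvClosed.Build (Aut T) GFF GFFV.

End LocalAction.

(* Main.v *)
(* Non-simplicity. Fix an edge e and let H be its stabilizer in G = G(F, F').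
   Since F' strictly contains F and preserves its orbits, there are non-trivial
   g1, g2 in G, each fixing pointwise one of the two half-trees cut out by e, and
   they commute. Every translate of e lies in one of these half-trees or is e, so
   (1 - g1)(1 - g2) acts as 0 on l^2(G / H). As H is amenable, l^2(G / H) is
   weakly contained in l^2(G): concretely, a sum z of elements
   a g (1 - g1)(1 - g2) k satisfies |1 - z| >= 1, as one sees by applying 1 - z to
   vectors of l^2(H) that are almost invariant under the elements of H occurring
   in z. Hence the ideal generated by (1 - g1)(1 - g2) is proper.

   H is amenable because an element of H whose local actions all lie in F is
   trivial, so H is exhausted by iterated extensions of direct sums of groups F'_a.
   Almost invariant vectors are obtained from an invariant mean m as follows: if
   there were none for a finite symmetric set S, then the averaging operator over
   S would have small norm and its Green function would be a function u > 0 with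
   sum_(s in S) u(s^-1 x) <= (|S| - delta) u(x); but s |-> m(log u(s^-1 x) - log
   u(x)) is odd, so it sums to 0 over S, contradicting log r <= r - 1. *)

Require Import Defs.
From HB Require Import structures.
From mathcomp Require Import all_boot all_order all_algebra.
From mathcomp Require Import all_classical all_reals all_analysis.
From mathcomp Require Import complex ring lra zify.

Set Implicit Arguments.
Unset Strict Implicit.
Unset Printing Implicit Defensive.

Import Order.TTheory GRing.Theory Num.Theory.
Import numFieldNormedType.Exports.
Import ComplexField.Normc.

(** * Invariant means *)

Section Means.
Local Open Scope classical_set_scope.
Local Open Scope ring_scope.
Variable R : realType.

Lemma bounded_funE (T : Type) (f : T -> R) :
  bounded_fun f <-> exists C : R, forall x, `|f x| <= C.
Proof.
split=> [[M [_ /(_ (M + 1))]]|[C fC]].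
  by rewrite ltrDl => /(_ ltr01) fM; exists (M + 1) => x; exact: fM.
by exists C; split=> [|D CD x _ /=];
  rewrite ?num_real// (le_trans (fC x))// ltW.
Qed.

(* Requiring positivity only on [A] is what makes the mean carried by [A]. *)
Record mean_on (G : groupType) (A : set G) (m : (G -> R) -> R) : Prop := {
  mean_onD : forall f h : G -> R, bounded_fun f -> bounded_fun h ->
    m (fun x => f x + h x) = m f + m h;
  mean_onZ : forall (a : R) (f : G -> R), bounded_fun f ->
    m (fun x => a * f x) = a * m f;
  mean_on_ge0 : forall f : G -> R, bounded_fun f ->
    (forall x, A x -> 0 <= f x) -> 0 <= m f;
  mean_on1 : m (fun=> 1) = 1;
  mean_on_inv : forall a (f : G -> R), A a -> bounded_fun f ->
    m (fun x => f (a * x)%g) = m f }.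

Definition amenable_on (G : groupType) (A : set G) := exists m, mean_on A m.

Lemma bounded_add T (f h : T -> R) :
  bounded_fun f -> bounded_fun h -> bounded_fun (fun x => f x + h x).
Proof.
move=> /bounded_funE[C fC] /bounded_funE[D hD]; apply/bounded_funE.
by exists (C + D) => x; rewrite (le_trans (ler_normD _ _))// lerD.
Qed.

Lemma bounded_scale T a (f : T -> R) :
  bounded_fun f -> bounded_fun (fun x => a * f x).
Proof.
move=> /bounded_funE[C fC]; apply/bounded_funE.
by exists (`|a| * C) => x; rewrite normrM ler_wpM2l.
Qed.

Lemma bounded_comp T T' (f : T -> R) (e : T' -> T) :
  bounded_fun f -> bounded_fun (fun x => f (e x)).
Proof. by move=> /bounded_funE[C fC]; apply/bounded_funE; exists C. Qed.

Lemma bounded_const T (a : R) : bounded_fun (fun _ : T => a).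
Proof. by apply/bounded_funE; exists `|a|. Qed.

Section MeanTheory.
Variables (G : groupType) (A : set G) (m : (G -> R) -> R).
Hypothesis mA : mean_on A m.
Implicit Types f h : G -> R.

Lemma mean_on_cst a : m (fun=> a) = a.
Proof.
have := mean_onZ mA a (bounded_const G 1).
by rewrite (mean_on1 mA) mulr1.
Qed.

Lemma mean_onN f : bounded_fun f -> m (fun x => - f x) = - m f.
Proof.
move=> fb; rewrite -mulN1r -(mean_onZ mA)//; congr m.
by apply/funext => x; rewrite mulN1r.
Qed.

Lemma mean_onB f h : bounded_fun f -> bounded_fun h ->
  m (fun x => f x - h x) = m f - m h.
Proof.
move=> fb hb; rewrite -(mean_onN hb) -(mean_onD mA)//.
rewrite (_ : (fun x => - h x) = (fun x => -1 * h x));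
  first exact: bounded_scale.
by apply/funext => x; rewrite mulN1r.
Qed.

Lemma mean_on_le f h : bounded_fun f -> bounded_fun h ->
  (forall x, A x -> f x <= h x) -> m f <= m h.
Proof.
move=> fb hb fh; rewrite -subr_ge0 -mean_onB// (mean_on_ge0 mA) => [//||x Ax].
  rewrite (_ : (fun x => _) = (fun x => h x + (-1) * f x)).
    by apply: bounded_add => //; exact: bounded_scale.
  by apply/funext => x; rewrite mulN1r.
by rewrite subr_ge0 fh.
Qed.

Lemma mean_on_eq f h : bounded_fun f -> bounded_fun h ->
  (forall x, A x -> f x = h x) -> m f = m h.
Proof.
by move=> fb hb fh; apply/le_anti; rewrite !mean_on_le// => x /fh->.
Qed.

Lemma mean_on_norm f C : (forall x, `|f x| <= C) -> `|m f| <= C.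
Proof.
move=> fC; have fb : bounded_fun f by apply/bounded_funE; exists C.
rewrite ler_norml -{1}(mean_on_cst (- C)) -{2}(mean_on_cst C).
by apply/andP; split; apply: mean_on_le => // [|x _]; try exact: bounded_const;
  have := fC x; rewrite ler_norml => /andP[].
Qed.

Lemma mean_on_sum (I : Type) (s : seq I) (f : I -> G -> R) :
  (forall i, bounded_fun (f i)) ->
  m (fun x => \sum_(i <- s) f i x) = \sum_(i <- s) m (f i).
Proof.
move=> fb; have [] // : bounded_fun (fun x => \sum_(i <- s) f i x) /\
  m (fun x => \sum_(i <- s) f i x) = \sum_(i <- s) m (f i).
elim: s => [|i s [sb IH]].
  rewrite big_nil (_ : (fun x => _) = fun=> 0).
    by rewrite mean_on_cst; split=> //; exact: bounded_const.
  by apply/funext => x; rewrite big_nil.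
rewrite big_cons (_ : (fun x => _) = fun x => f i x + \sum_(j <- s) f j x).
  by rewrite (mean_onD mA)// IH; split=> //; exact: bounded_add.
by apply/funext => x; rewrite big_cons.
Qed.

End MeanTheory.

Lemma amenable_on1 (G : groupType) : amenable_on [set 1%g : G].
Proof.
exists (fun f => f 1%g); split=> // [f _ /(_ 1%g erefl)//|a f -> _].
by rewrite mul1g.
Qed.

Lemma amenable_on_image (K G : groupType) (phi : K -> G) :
  {morph phi : x y / (x * y)%g} -> amenable R K -> amenable_on (range phi).
Proof.
move=> phiM [m mK]; exists (fun f => m (fun x => f (phi x))); split.
- move=> f h fb hb; exact: meanD mK _ _ (bounded_comp _ fb) (bounded_comp _ hb).
- move=> a f fb; exact: meanZ mK a _ (bounded_comp _ fb).
- move=> f fb f0; apply: (mean_ge0 mK) => [|x]; first exact: bounded_comp.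
  by apply: f0; exists x.
- exact: mean1 mK.
- move=> _ f [k _ <-] fb.
  rewrite -[RHS](mean_invariant mK k); last exact: (bounded_comp phi fb).
  by congr m; apply/funext => x; rewrite phiM.
Qed.

(** The mean averages over [N] first, then over [A]. A translation by [a * n] is absorbed since
    [n * x = x * (x^-1 * n * x)], where only [x] in [A] counts for the outer mean. *)
Lemma amenable_on_mul (G : groupType) (A N : set G) :
  (forall a n, A a -> N n -> N (a^-1 * n * a)%g) ->
  amenable_on A -> amenable_on N ->
  amenable_on [set (a * n)%g | a in A & n in N].
Proof.
move=> AN [m mA] [k kN].
have kb f (fb : bounded_fun f) :
  bounded_fun (fun a => k (fun n => f (a * n)%g)).
  move/bounded_funE: fb => [C fC]; apply/bounded_funE; exists C => a.
  exact: (mean_on_norm kN).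
exists (fun f => m (fun a => k (fun n => f (a * n)%g))); split.
- move=> f h fb hb; rewrite -(mean_onD mA) //; [|exact: kb..]; congr (m _);
  apply/funext => a.
  by rewrite (mean_onD kN)//; exact: bounded_comp.
- move=> a f fb; rewrite -(mean_onZ mA) //; [|exact: kb]; congr (m _);
  apply/funext => b.
  by rewrite (mean_onZ kN)//; exact: bounded_comp.
- move=> f fb f0; apply: (mean_on_ge0 mA) => [|a Aa]; first exact: kb.
  apply: (mean_on_ge0 kN) => [|n Nn]; first exact: bounded_comp.
  by apply: f0; exists a => //; exists n.
- by rewrite (mean_on_cst kN) (mean_on_cst mA).
- move=> _ f [a Aa [n Nn <-]] fb.
  have -> : m (fun x => k (fun y => f (a * n * (x * y))%g)) =
      m (fun x => k (fun y => f (a * x * y)%g)).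
    apply: (mean_on_eq mA) => [||x Ax].
    + by apply: (kb (fun z => f (a * n * z)%g)); exact: bounded_comp.
    + rewrite (_ : (fun x => _) = (fun x => k (fun y => f (a * (x * y))%g))).
        by apply: (kb (fun z => f (a * z)%g)); exact: bounded_comp.
      by apply/funext => x; congr k; apply/funext => y; rewrite mulgA.
    + rewrite -[RHS](mean_on_inv kN (AN _ _ Ax Nn)); last exact: bounded_comp.
      by congr k; apply/funext => y; rewrite !mulgA mulgK.
  exact: (mean_on_inv mA Aa (kb _ fb)).
Qed.

Lemma fmap_ultra (T U : Type) (f : T -> U) (F : set_system T) :
  UltraFilter F -> UltraFilter (fmap f F).
Proof.
move=> FU; split=> [|H HP FH]; first exact: fmap_proper_filter.
apply/seteqP; split=> [S HS|]; last exact: FH.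
have [//|nS] := in_ultra_setVsetC (f @^-1` S) FU.
have /FH HnS : fmap f F (~` S) by [].
by have /filter_ex[x []] : H (S `&` ~` S) by exact: filterI.
Qed.

(** On a bounded function the means of the [A n] form a bounded sequence, which by compactness
    converges along an ultrafilter finer than [\oo]. The limit is invariant because each element
    lies in [A n] from some index on. *)
Lemma amenable_on_bigcup (G : groupType) (A : (set G)^nat) :
  {homo A : n p / (n <= p)%N >-> n `<=` p} ->
  (forall n, amenable_on (A n)) -> amenable_on (\bigcup_n A n).
Proof.
move=> A_incr Aam; pose m n := projT1 (cid (Aam n)).
have mA n : mean_on (A n) (m n) by rewrite /m; case: cid.
have [U [UF oU]] := ultraFilterLemma (eventually_filter : ProperFilter \oo).
have cvU f : bounded_fun f -> cvg ((fun n => m n f) @ U).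
  move=> /bounded_funE[C fC].
  have : compact [set` `[- C, C]%R] by exact: segment_compact.
  rewrite compact_ultra => /(_ (fmap (fun n => m n f) U)).
  case=> [||x [_ xU]]; last by apply/cvg_ex; exists x.
    exact: fmap_ultra.
  change (U [set n | [set` `[- C, C]] (m n f)]).
  apply: filterS (@filterT _ U _) => n _ /=.
  by rewrite in_itv/= -ler_norml; exact: (mean_on_norm (mA n)).
pose M f := lim ((fun n => m n f) @ U).
have ME f l : (fun n => m n f) @ U --> l -> M f = l by exact: cvg_lim.
have toM f : bounded_fun f -> (fun n => m n f) @ U --> M f by move=> /cvU.
exists M; split.
- move=> f h fb hb; apply: ME.
  rewrite (_ : (fun n => _) = (fun n => m n f + m n h)).
    by apply: cvgD; exact: toM.
  by apply/funext => n; rewrite (mean_onD (mA n)).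
- move=> a f fb; apply: ME.
  rewrite (_ : (fun n => _) = (fun n => a * m n f)).
    by apply: cvgMr; exact: toM.
  by apply/funext => n; rewrite (mean_onZ (mA n)).
- move=> f fb f0; apply: limr_ge; first exact: cvU.
  apply: filterS (@filterT _ U _) => n _ /=.
  by apply: (mean_on_ge0 (mA n)) => // x Ax; apply: f0; exists n.
- apply: ME; rewrite (_ : (fun n => _) = fun=> 1); first exact: cvg_cst.
  by apply/funext => n; rewrite (mean_on1 (mA n)).
- move=> a f [p _ Apa] fb; apply: ME.
  apply: cvg_trans (toM _ fb); apply: near_eq_cvg.
  apply: oU; exists p => // n /= pn.
  by rewrite (mean_on_inv (mA n))//; exact: A_incr Apa.
Qed.

End Means.

(** * The Hilbert space of a discrete group *)

Section L2Norm.
Local Open Scope classical_set_scope.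
Local Open Scope ring_scope.
Variables (R : realType) (G : groupType).
Local Notation l2 := (l2 R G).
Implicit Types (xi eta zeta : l2) (g x : G).

Lemma esumZl (T : choiceType) (a : R) (f : T -> \bar R) : 0 <= a ->
  (forall y, (0 <= f y)%E) ->
  (\esum_(y in [set: T]) (a%:E * f y) = a%:E * \esum_(y in [set: T]) f y)%E.
Proof.
have le b (h : T -> \bar R) : 0 <= b -> (forall y, (0 <= h y)%E) ->
    (\esum_(y in [set: T]) (b%:E * h y) <= b%:E * \esum_(y in [set: T]) h y)%E.
  move=> b0 h0; apply: ge_ereal_sup => _ [X [finX XT] <-].
  rewrite -ge0_mule_fsumr// lee_wpmul2l ?lee_fin//.
  by apply: ereal_sup_ubound; exists X.
move=> a0 f0; apply/le_anti; rewrite le//=.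
have [->|an0] := eqVneq a 0.
  by rewrite mul0e; apply: esum_ge0 => y _; rewrite mul0e.
have agt0 : 0 < a by rewrite lt_neqAle eq_sym an0.
rewrite -lee_pdivlMl//; apply: le_trans (le _ _ _ _); rewrite ?invr_ge0//.
  by apply: le_esum => y _; rewrite muleA -EFinM mulVf// mul1e.
by move=> y; rewrite mule_ge0.
Qed.

Lemma sqnorm_ge0 (f : G -> R[i]) : (0 <= sqnorm f)%E.
Proof. by apply: esum_ge0 => x _; rewrite lee_fin sqr_ge0. Qed.

Lemma sqnormE xi : sqnorm xi = (l2norm xi ^+ 2)%:E.
Proof.
rewrite /l2norm sqr_sqrtr ?fine_ge0 ?sqnorm_ge0// fineK//
  ge0_fin_numE ?sqnorm_ge0//.
by case: xi => f /= /asboolP.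
Qed.

Lemma l2norm_ge0 xi : 0 <= l2norm xi. Proof. exact: sqrtr_ge0. Qed.

Lemma normc_ge0 (z : R[i]) : 0 <= normc z. Proof. by case: z => u v;
  exact: sqrtr_ge0. Qed.

(** Sums of squares are monotone, and linear for non-negative weights. This stands in for an inner
    product in the scaling, triangle and parallelogram inequalities. *)
Lemma l2norm_comb (a1 a2 b1 b2 : R) (xi1 xi2 eta1 eta2 : l2) :
  0 <= a1 -> 0 <= a2 -> 0 <= b1 -> 0 <= b2 ->
  (forall x, a1 * normc (xi1 x) ^+ 2 + a2 * normc (xi2 x) ^+ 2 <=
             b1 * normc (eta1 x) ^+ 2 + b2 * normc (eta2 x) ^+ 2) ->
  a1 * l2norm xi1 ^+ 2 + a2 * l2norm xi2 ^+ 2 <=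
  b1 * l2norm eta1 ^+ 2 + b2 * l2norm eta2 ^+ 2.
Proof.
move=> a10 a20 b10 b20 le.
have E (a b : R) (u v : l2) : 0 <= a -> 0 <= b ->
    ((a * l2norm u ^+ 2 + b * l2norm v ^+ 2)%:E =
     \esum_(x in [set: G]) (a * normc (u x) ^+ 2 + b * normc (v x) ^+ 2)%:E)%E.
  move=> a0 b0; rewrite EFinD [(a * _)%:E]EFinM [(b * _)%:E]EFinM -!sqnormE
    /sqnorm -!esumZl//; last 2 first.
  - by move=> x; rewrite lee_fin sqr_ge0.
  - by move=> x; rewrite lee_fin sqr_ge0.
  rewrite -esumD => [|x _|x _]; first by apply: eq_esum => x _; rewrite EFinD.
  - by rewrite -EFinM lee_fin mulr_ge0 ?sqr_ge0.
  - by rewrite -EFinM lee_fin mulr_ge0 ?sqr_ge0.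
by rewrite -lee_fin !E//; apply: le_esum => x _; rewrite lee_fin.
Qed.

Lemma l2norm_mono (C : R) xi eta : 0 <= C ->
  (forall x, normc (xi x) <= C * normc (eta x)) -> l2norm xi <= C * l2norm eta.
Proof.
move=> C0 le; rewrite -ler_sqr ?nnegrE ?mulr_ge0 ?l2norm_ge0//.
have := @l2norm_comb 1 0 (C ^+ 2) 0 xi xi eta eta ler01 (lexx _) (sqr_ge0 _)
  (lexx _).
rewrite !mul1r !mul0r !addr0 exprMn; apply => x.
by rewrite !mul1r !mul0r !addr0 -exprMn ler_sqr ?nnegrE ?mulr_ge0 ?normc_ge0.
Qed.

Lemma l2norm_point xi x : normc (xi x) <= l2norm xi.
Proof.
rewrite -ler_sqr ?nnegrE ?normc_ge0 ?l2norm_ge0// -lee_fin -sqnormE.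
apply: esum_ge; exists [set x]; first by split=> //; exact: finite_set1.
by rewrite fsbig_set1.
Qed.

Lemma l2E xi eta : xi =1 eta -> xi = eta.
Proof. by move=> E; apply/val_inj/funext. Qed.

Lemma l20E x : (0 : l2) x = 0. Proof. by []. Qed.
Lemma l2ZE (a : R[i]) xi x : (a *: xi) x = a * xi x. Proof. by []. Qed.
Lemma l2DE xi eta x : (xi + eta) x = xi x + eta x. Proof. by []. Qed.
Lemma l2NE xi x : (- xi) x = - xi x. Proof. by []. Qed.

Lemma l2norm_eq0 xi : l2norm xi = 0 -> xi = 0.
Proof.
move=> E; apply: l2E => x; apply: (@eq0_normc R).
by apply/le_anti; rewrite normc_ge0 -[X in _ <= X]E l2norm_point.
Qed.

Lemma l2normZ (a : R[i]) xi : l2norm (a *: xi) = normc a * l2norm xi.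
Proof.
apply/le_anti/andP; split.
  by apply: l2norm_mono (normc_ge0 _) _ => x; rewrite l2ZE normcM.
have [->|a0] := eqVneq a 0.
  by rewrite normc0 mul0r l2norm_ge0.
have na : 0 < normc a.
  by rewrite lt_neqAle normc_ge0 andbT eq_sym;
    apply: contra a0 => /eqP/eq0_normc->.
rewrite -ler_pdivlMl//; apply: l2norm_mono; first by rewrite invr_ge0 ltW.
by move=> x; rewrite l2ZE normcM mulKf// gt_eqF.
Qed.

Lemma l2norm0 : l2norm (0 : l2) = 0.
Proof. by rewrite -(scale0r (0 : l2)) l2normZ normc0 mul0r. Qed.

Lemma l2normD xi eta : l2norm (xi + eta) <= l2norm xi + l2norm eta.
Proof.
have [/l2norm_eq0->|xi0] := eqVneq (l2norm xi) 0;
  first by rewrite l2norm0 !add0r.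
have [/l2norm_eq0->|eta0] := eqVneq (l2norm eta) 0;
  first by rewrite l2norm0 !addr0.
set a := l2norm xi in xi0 *; set b := l2norm eta in eta0 *.
have agt0 : 0 < a by rewrite lt_neqAle eq_sym xi0 l2norm_ge0.
have bgt0 : 0 < b by rewrite lt_neqAle eq_sym eta0 l2norm_ge0.
rewrite -ler_sqr ?nnegrE ?addr_ge0 ?(ltW agt0) ?(ltW bgt0) ?l2norm_ge0//.
(* In [(p + q)^2 <= (1 + t) p^2 + (1 + 1/t) q^2] the weight [t = b / a] is the one for which the
   summed bound equals [(a + b)^2]. *)
have t0 : 0 < b / a by rewrite divr_gt0.
have := @l2norm_comb 1 0 (1 + b / a) (1 + (b / a)^-1) (xi + eta) 0 xi eta.
rewrite !mul1r !mul0r !addr0 -/a -/b.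
have -> : (1 + b / a) * a ^+ 2 + (1 + (b / a)^-1) * b ^+ 2 = (a + b) ^+ 2.
  by field; rewrite xi0 eta0.
apply=> // [||x]; try by rewrite addr_ge0// ?invr_ge0 ltW.
rewrite !mul1r !mul0r !addr0.
apply: (@le_trans _ _ ((normc (xi x) + normc (eta x)) ^+ 2)).
  by rewrite ler_sqr ?nnegrE ?addr_ge0 ?normc_ge0//; by rewrite l2DE;
    exact: le_normcD.
set p := normc (xi x); set q := normc (eta x); set t := b / a in t0 *.
rewrite -subr_ge0.
have -> : (1 + t) * p ^+ 2 + (1 + t^-1) * q ^+ 2 - (p + q) ^+ 2
    = t^-1 * (t * p - q) ^+ 2 by field; rewrite gt_eqF.
by rewrite mulr_ge0 ?sqr_ge0 ?invr_ge0 ?ltW.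
Qed.

Lemma l2normB xi eta : l2norm xi - l2norm eta <= l2norm (xi - eta).
Proof. by rewrite lerBlDr -{1}(subrK eta xi) l2normD. Qed.

Lemma l2norm_sum (I : Type) (s : seq I) (f : I -> l2) :
  l2norm (\sum_(i <- s) f i) <= \sum_(i <- s) l2norm (f i).
Proof.
elim: s => [|i s IH]; first by rewrite !big_nil l2norm0.
by rewrite !big_cons (le_trans (l2normD _ _))// lerD2l.
Qed.

Lemma sqr_normc (z : R[i]) : normc z ^+ 2 = complex.Re z ^+ 2 + complex.Im z ^+
  2.
Proof. by case: z => u v /=; rewrite sqr_sqrtr// addr_ge0 ?sqr_ge0. Qed.

Lemma l2norm_parallelogram xi eta :
  l2norm (xi + eta) ^+ 2 + l2norm (xi - eta) ^+ 2 <=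
  2 * l2norm xi ^+ 2 + 2 * l2norm eta ^+ 2.
Proof.
have := @l2norm_comb 1 1 2 2 (xi + eta) (xi - eta) xi eta.
rewrite !mul1r; apply=> // x; rewrite !mul1r !sqr_normc.
rewrite !l2DE l2NE.
by case: (xi x) (eta x) => [p q] [r s] /=; lra.
Qed.

Lemma l2norm_left_regular g xi : l2norm (left_regular g xi) = l2norm xi.
Proof.
rewrite /l2norm; congr (Num.sqrt (fine _)).
rewrite /sqnorm [RHS](@reindex_esum R G G setT setT (fun x :
  G => (g^-1 * x)%g))//.
split=> // [x y _ _ /mulgI//|x _]; exists (g * x)%g => //.
by rewrite mulKg.
Qed.

Lemma left_regularE g xi x : left_regular g xi x = xi (g^-1 * x)%g.
Proof. by []. Qed.

Lemma left_regularM g h xi :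
  left_regular (g * h)%g xi = left_regular g (left_regular h xi).
Proof. by apply: l2E => x /=; rewrite invgM mulgA. Qed.

Lemma left_regular_linear g : linear (left_regular g : l2 -> l2).
Proof. by move=> a xi eta; apply: l2E. Qed.

End L2Norm.

(** * Almost invariant vectors *)

Section Kesten.
Local Open Scope classical_set_scope.
Local Open Scope ring_scope.
Variables (R : realType) (G : groupType) (A : set G).
Hypothesis A_inv : forall x y, A x -> (A (x^-1 * y)%g <-> A y).
Local Notation l2 := (l2 R G).
Implicit Types (xi eta zeta : l2) (g h x : G) (S : seq G).

(** The weights [1 / 2^(n+1)] along an enumeration of [G], cut off outside [A], are at most 1, so
    their squares are summable with them. *)
Lemma square_summable_positive : countable [set: G] ->
  exists xi : l2, exists2 f : G -> R, forall x, xi x = (f x)%:C%C &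
    (forall x, A x -> 0 < f x) /\ (forall x, ~ A x -> f x = 0).
Proof.
move=> /countable_injP[e e_inj].
pose w n : R := 1 / (2 ^ n.+1)%:R.
have w0 n : 0 < w n by rewrite divr_gt0 ?ltr01// ltr0n expn_gt0.
have w1 n : w n <= 1.
  by rewrite /w div1r invf_le1 ?ltr0n ?expn_gt0// ler1n expn_gt0.
pose f x := if `[< A x >] then w (e x) else 0.
have fE x : normc ((f x)%:C%C : R[i]) = f x.
  rewrite /= expr0n addr0 sqrtr_sqr ger0_norm// /f.
  by case: ifP => // _; exact: ltW.
have fS : (fun x => (f x)%:C%C : R[i]^o) \in @square_summable R G.
  apply/asboolP; rewrite /sqnorm.
  apply: (@le_lt_trans _ _ (\esum_(x in [set: G]) (w (e x))%:E)).
    apply: le_esum => x _; rewrite fE lee_fin /f; case: ifP => _.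
      by rewrite expr2 -[leRHS]mulr1 ler_wpM2l// ltW.
    by rewrite expr0n ltW.
  rewrite -(@esum_image _ _ _ setT e (fun n => (w n)%:E)); last first.
    by move=> x y; exact: e_inj.
  apply: (@le_lt_trans _ _ 1%:E); last by rewrite ltry.
  apply: le_trans (epsilon_trick0 xpredT ler01).
  rewrite nneseries_esumT => [|n]; last first.
    by rewrite /= lee_fin; exact: ltW (w0 n).
  rewrite esum_mkcond; apply: le_esum => n _; case: ifP => _ //=.
exists (L2 fS); exists f => //; split=> x Ax; rewrite /f.
  by rewrite asboolT.
by rewrite asboolF.
Qed.

Lemma normc_Re (z : R[i]) : `|complex.Re z| <= normc z.
Proof.
by case: z => u v /=; rewrite -sqrtr_sqr ler_wsqrtr// lerDl sqr_ge0.
Qed.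

Lemma sum_const_seq (I : Type) (s : seq I) (a : R) :
  \sum_(i <- s) a = (size s)%:R * a.
Proof. by rewrite big_const_seq count_predT iter_addr_0 mulr_natl. Qed.

(** Each translation is paired with the identity because [left_regular s xi + xi] is what the
    parallelogram inequality bounds when [s] moves [xi]. *)
Definition averaging S xi : l2 := \sum_(s <- S) (left_regular s xi + xi).

Lemma averagingE S xi x :
  averaging S xi x = \sum_(s <- S) (xi (s^-1 * x)%g + xi x).
Proof.
rewrite /averaging; elim: S => [|s S IH]; first by rewrite !big_nil.
by rewrite !big_cons -IH l2DE.
Qed.

Section Supersolution.
Variables (S : seq G) (rho theta : R) (xi0 : l2) (f0 : G -> R).
Hypotheses (SA : forall s, s \in S ->
  A s) (rho0 : 0 <= rho) (rho_theta : rho < theta).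
Hypothesis averaging_le : forall xi, (forall x, ~ A x -> xi x = 0) ->
  l2norm (averaging S xi) <= rho * l2norm xi.
Hypotheses (xi0E : forall x, xi0 x = (f0 x)%:C%C).
Hypotheses (f0_gt0 : forall x, A x -> 0 < f0 x) (f0_eq0 : forall x, ~ A x ->
  f0 x = 0).

(* The Green function [sum_n theta^(-n) Y^n xi0] of the averaging operator [Y],
   whose norm is less than [theta]. *)
Lemma supersolution : exists u : G -> R, [/\ forall x, A x -> 0 < u x,
  forall x, ~ A x -> u x = 0 &
  forall x, \sum_(s <- S) (u (s^-1 * x)%g + u x) <= theta * u x].
Proof.
have theta0 : 0 < theta by exact: le_lt_trans rho_theta.
pose xi n := iter n (averaging S) xi0.
have xi_supp n x : ~ A x -> xi n x = 0.
  elim: n x => [|n IH] x nAx; first by rewrite /xi /= xi0E f0_eq0.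
  rewrite /xi iterS averagingE big1_seq// => s /andP[_ sS].
  by rewrite !IH ?addr0// => /(A_inv _ (SA sS)).
have xi_norm n : l2norm (xi n) <= rho ^+ n * l2norm xi0.
  elim: n => [|n IH]; first by rewrite mul1r.
  rewrite /xi iterS (le_trans (averaging_le (xi_supp n)))//.
  by rewrite exprS -mulrA ler_wpM2l.
(* The terms of the Green series; real parts turn the complex vectors into real functions, which are
   non-negative by [fS] and induction. *)
pose f n x := theta ^- n * complex.Re (xi n x).
have f0E x : f 0%N x = f0 x by rewrite /f /xi /= invr1 mul1r xi0E.
have fS n x : \sum_(s <- S) (f n (s^-1 * x)%g + f n x) = theta * f n.+1 x.
  rewrite /f /xi iterS averagingE -/(xi n) raddf_sum/= !mulr_sumr.
  apply: eq_bigr => s _; rewrite raddfD/= -mulrDr exprS invfM !mulrA.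
  by rewrite mulfV ?mul1r// gt_eqF.
have f_ge0 n x : 0 <= f n x.
  elim: n x => [|n IH] x.
    by rewrite f0E; case: (pselect (A x)) => [/f0_gt0/ltW//|/f0_eq0->].
  rewrite -(pmulr_rge0 _ theta0) -fS; apply: sumr_ge0 => s _.
  by rewrite addr_ge0.
set r := rho / theta.
have r0 : 0 <= r by rewrite divr_ge0// ltW.
have r1 : r < 1 by rewrite ltr_pdivrMr// mul1r.
set C := l2norm xi0.
have f_le n x : f n x <= r ^+ n * C.
  rewrite /f expr_div_n mulrAC [leRHS]mulrC ler_wpM2l ?invr_ge0 ?exprn_ge0
    ?(ltW theta0)//.
  apply: le_trans (xi_norm n); apply: le_trans (l2norm_point (xi n) x).
  exact: le_trans (ler_norm _) (normc_Re _).
pose U x n := \sum_(k < n) f k x.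
have U_homo x : {homo U x : n p / (n <= p)%N >-> n <= p}.
  move=> n p np; rewrite /U -(subnKC np) big_split_ord/= lerDl.
  by apply: sumr_ge0 => k _.
have U_le x n : U x n <= (1 - r)^-1 * C.
  have r1' : 0 < 1 - r by rewrite subr_gt0.
  apply: (@le_trans _ _ (((1 - r ^+ n) / (1 - r)) * C)); last first.
    rewrite ler_wpM2r ?l2norm_ge0//
      -[leRHS]mul1r ler_wpM2r ?invr_ge0 ?(ltW r1')//.
    by rewrite gerBl exprn_ge0.
  elim: n => [|n IH]; first by rewrite /U big_ord0 subrr !mul0r.
  rewrite /U big_ord_recr /= (le_trans (lerD IH (f_le n x)))//.
  rewrite -mulrDl ler_wpM2r ?l2norm_ge0// exprS le_eqVlt; apply/orP; left.
  by apply/eqP; field; rewrite gt_eqF.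
have U_cvg x : cvgn (U x).
  apply: nondecreasing_is_cvgn (U_homo x) _.
  by exists ((1 - r)^-1 * C) => _ [n _ <-].
pose u x := limn (U x).
have U_u x n : U x n <= u x by exact: nondecreasing_cvgn_le.
exists u; split=> x.
- move=> Ax; apply: lt_le_trans (U_u x 1%N).
  by rewrite /U big_ord1 f0E f0_gt0.
- move=> nAx; rewrite /u (_ : U x = fun=> 0) ?lim_cst//.
  apply/funext => n; apply: big1 => k _.
  by rewrite /f xi_supp// raddf0 mulr0.
- have cvS : (fun n => \sum_(s <- S) (U (s^-1 * x)%g n + U x n)) @ \oo -->
      \sum_(s <- S) (u (s^-1 * x)%g + u x).
    elim: (S) => [|s S' IH].
      rewrite big_nil (_ : (fun n => _) = fun=> 0); first exact: cvg_cst.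
      by apply/funext => n; rewrite big_nil.
    rewrite big_cons (_ : (fun n => _) = fun n => (U (s^-1 * x)%g n + U x n) +
        \sum_(t <- S') (U (t^-1 * x)%g n + U x n)).
      by apply: cvgD => //; apply: cvgD; exact: U_cvg.
    by apply/funext => n; rewrite big_cons.
  rewrite -(cvg_lim _ cvS)//; apply: limr_le; first by apply/cvg_ex; eexists;
    exact: cvS.
  (* By [fS], averaging the partial sum of length [n] gives [theta] times the one of length [n.+1]
     without its first term, which is non-negative. *)
  apply: nearW => n; apply: (@le_trans _ _ (theta * U x n.+1)); last first.
    by rewrite ler_wpM2l// ltW.
  rewrite [U x n.+1]big_ord_recl /= mulrDr -[leLHS]add0r lerD//.
    by rewrite mulr_ge0// ltW.
  rewrite le_eqVlt mulr_sumr; apply/orP; left; apply/eqP.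
  under eq_bigr do rewrite -big_split.
  by rewrite exchange_big /=; apply: eq_bigr => k _; rewrite fS.
Qed.

End Supersolution.

Lemma ln_le_subr1 (x : R) : 0 < x -> ln x <= x - 1.
Proof.
by move=> x0; rewrite -{1}(subrKC 1 x) le_ln1Dx// ltrBDl subrr.
Qed.

(* The logarithm of a positive supersolution has bounded increments; their
   means form a homomorphism, so they cancel out on a symmetric set. *)
Lemma no_supersolution (m : (G -> R) -> R) (S0 : seq G) (delta : R) (u : G ->
  R) :
  mean_on A m -> 0 < delta -> (forall s, s \in S0 -> A s) ->
  (forall x, A x -> 0 < u x) -> (forall x, ~ A x -> u x = 0) ->
  let S := S0 ++ [seq s^-1%g | s <- S0] in
  ~ (forall x, A x ->
      \sum_(s <- S) u (s^-1 * x)%g <= ((size S)%:R - delta) * u x).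
Proof.
move=> mA delta0 S0A u0 uN S uS.
have A1 s : A s -> A s^-1%g.
  move=> As; have := (A_inv s As).2 As; rewrite mulVg => A1.
  by have := (A_inv 1%g As).2 A1; rewrite mulg1.
have SV s : s \in S -> s^-1%g \in S.
  rewrite !mem_cat => /orP[sS|/mapP[t tS ->]]; last by rewrite invgK tS.
  by rewrite map_f ?orbT.
have SA s : s \in S -> A s.
  by rewrite mem_cat => /orP[/S0A//|/mapP[t /S0A/A1 ? ->]].
have u_ge0 x : 0 <= u x.
  by case: (pselect (A x)) => [/u0/ltW//|/uN->].
pose D s x := ln (u (s^-1 * x)%g) - ln (u x).
have D_out s x : s \in S -> ~ A x -> D s x = 0.
  by move=> /SA sA nAx; rewrite /D !uN ?subrr// => /(A_inv x sA).
have DE s x : s \in S -> A x -> D s x = ln (u (s^-1 * x)%g / u x).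
  by move=> /SA sA Ax; rewrite ln_div ?posrE ?u0//; exact/A_inv.
(* One term of the supersolution sum is at most the whole, which bounds [u (s^-1 * x) / u x] by
   [size S]. The lower bound on [D] then follows from the antisymmetry [DV]. *)
have D_le s x : s \in S -> D s x <= (size S)%:R.
  move=> sS; have [Ax|/(D_out s x sS)->//] := pselect (A x).
  have ux := u0 x Ax; have usx : 0 < u (s^-1 * x)%g by apply/u0/A_inv => //;
    exact: SA.
  rewrite DE// (le_trans (ln_le_subr1 _)) ?divr_gt0//.
  rewrite lerBlDr (le_trans _ (ler_wpDr ler01 (lexx _)))// ler_pdivrMr//.
  apply: (@le_trans _ _ (\sum_(t <- S) u (t^-1 * x)%g)).
    rewrite (big_rem s)//= lerDl; apply: sumr_ge0 => t _; exact: u_ge0.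
  by rewrite (le_trans (uS x Ax))// ler_wpM2r// gerBl ltW.
have DV s x : D s^-1%g (s^-1 * x)%g = - D s x.
  by rewrite /D invgK mulgA mulgV mul1g opprB.
have Db s : s \in S -> bounded_fun (D s).
  move=> sS; apply/bounded_funE; exists (size S)%:R => x.
  rewrite ler_norml D_le// andbT lerNl -DV D_le//; exact: SV.
have mDV s : s \in S -> m (D s^-1%g) = - m (D s).
  move=> sS; rewrite -(mean_onN mA (Db s sS)).
  rewrite -(mean_on_inv mA (A1 s (SA s sS)) (Db _ (SV s sS))).
  by congr (m _); apply/funext => x; rewrite DV.
have sum0 : \sum_(s <- S) m (D s) = 0.
  rewrite /S big_cat /= big_map -big_split /= big1_seq// => s /andP[_ sS].
  by rewrite mDV ?subrr// mem_cat sS.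
(* [mean_on_sum] asks for boundedness at every index, hence the value 0 outside [S]. *)
have Db' s : bounded_fun (fun x => if s \in S then D s x else 0).
  by case: (boolP (s \in S)) => [/Db//|_]; exact: bounded_const.
have : m (fun x => \sum_(s <- S) (if s \in S then D s x else 0)) <= - delta.
  rewrite -(mean_on_cst mA (- delta)); apply: (mean_on_le mA) => [||x Ax].
  - apply/bounded_funE; exists (\sum_(s <- S) (size S)%:R) => x.
    rewrite (le_trans (ler_norm_sum _ _ _))// big_seq [leRHS]big_seq.
    apply: ler_sum => s sS; rewrite sS ler_norml D_le// andbT lerNl -DV D_le//.
    exact: SV.
  - exact: bounded_const.
  - have ux := u0 x Ax.
    apply: (@le_trans _ _ (\sum_(s <- S) (u (s^-1 * x)%g / u x - 1))).
      rewrite big_seq [leRHS]big_seq; apply: ler_sum => s sS.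
      rewrite sS DE// ln_le_subr1// divr_gt0//; apply/u0/A_inv => //; exact: SA.
    rewrite sumrB -mulr_suml sum_const_seq lerBlDr ler_pdivrMr//.
    rewrite (le_trans (uS x Ax))//. 
    by rewrite mulr1 addrC.
rewrite (mean_on_sum mA S Db').
rewrite (_ : \sum_(s <- S) _ = 0); first by rewrite lerNr oppr0 leNgt delta0.
rewrite -[RHS]sum0 big_seq [RHS]big_seq; apply: eq_bigr => s sS.
by rewrite sS.
Qed.

(* Without almost invariant vectors, the parallelogram identity would bound the
   averaging operator away from its trivial bound [2 * size S]. *)
Theorem almost_invariant_vectors : countable [set: G] -> amenable_on R A ->
  forall (S0 : seq G) (eps : R), (forall s, s \in S0 -> A s) -> 0 < eps ->
  exists zeta : l2, [/\ l2norm zeta != 0, forall x, ~ A x -> zeta x = 0 &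
    forall s, s \in S0 -> l2norm (left_regular s zeta - zeta) <= eps * l2norm
      zeta].
Proof.
move=> Gc [m mA] S0 eps S0A eps0; apply: contrapT => no_ai.
(* Chosen so that [4 - eps^2 <= (2 - delta)^2], which turns the parallelogram inequality into [gap];
   [delta <= 1] keeps [2 - delta] and the later [rho] non-negative. *)
pose delta := Num.min 1 (eps ^+ 2 / 4).
have d0 : 0 < delta by rewrite lt_min ltr01 divr_gt0// exprn_gt0.
have d1 : delta <= 1 by rewrite ge_min lexx.
have de : delta <= eps ^+ 2 / 4 by rewrite ge_min lexx orbT.
have gap xi : (forall x, ~ A x -> xi x = 0) -> l2norm xi != 0 ->
    exists2 s, s \in S0 & l2norm (left_regular s xi + xi) <= (2 - delta) *
      l2norm xi.
  move=> xiA xi0; have [s sS sxi] : exists2 s, s \in S0 &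
      eps * l2norm xi < l2norm (left_regular s xi - xi).
    apply: contrapT => nos; apply: no_ai; exists xi; split=> // s sS.
    by rewrite leNgt; apply/negP => sxi; apply: nos; exists s.
  exists s => //; rewrite -ler_sqr ?nnegrE ?mulr_ge0 ?l2norm_ge0//; last by lra.
  have := l2norm_parallelogram (left_regular s xi) xi.
  rewrite l2norm_left_regular; move: sxi.
  rewrite -ltr_sqr ?nnegrE ?mulr_ge0 ?l2norm_ge0 ?(ltW eps0)// !exprMn.
  have := sqr_ge0 (l2norm xi); set n := l2norm xi ^+ 2.
  set p := l2norm _ ^+ 2; set q := l2norm _ ^+ 2 => n0.
  have : (4 - eps ^+ 2) * n <= (2 - delta) ^+ 2 * n by apply: ler_wpM2r => //;
    nra.
  nra.
pose S := S0 ++ [seq s^-1%g | s <- S0].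
have SA s : s \in S -> A s.
  rewrite mem_cat => /orP[/S0A//|/mapP[t /S0A tA ->]].
  have := (A_inv t tA).2 tA; rewrite mulVg => A1.
  by have := (A_inv 1%g tA).2 A1; rewrite mulg1.
have averaging_le xi : (forall x, ~ A x -> xi x = 0) ->
    l2norm (averaging S xi) <= (2 * (size S)%:R - delta) * l2norm xi.
  move=> xiA; have [xi0|xi0] := eqVneq (l2norm xi) 0.
    rewrite (l2norm_eq0 xi0) (_ : averaging S 0 = 0) ?l2norm0 ?mulr0//.
    by apply: l2E => x; rewrite averagingE big1// => s _; rewrite !l20E addr0.
  have [s sS sxi] := gap xi xiA xi0.
  have sS' : s \in S by rewrite mem_cat sS.
  rewrite /averaging (le_trans (l2norm_sum _ _))// (big_rem s)//=.
  have tri t : l2norm (left_regular t xi + xi) <= 2 * l2norm xi.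
    by rewrite (le_trans (l2normD _ _))//
      l2norm_left_regular mulr2n mulrDl mul1r.
  apply: (@le_trans _ _ ((2 - delta) * l2norm xi + \sum_(t <- rem s S) 2 *
    l2norm xi)).
    by apply: lerD => //; apply: ler_sum => t _; exact: tri.
  rewrite sum_const_seq size_rem//.
  have : (0 < size S)%N by case: (S) sS'.
  case: (size S) => // N _ /=; rewrite -[in leRHS]natr1.
  by rewrite le_eqVlt; apply/orP; left; apply/eqP; ring.
have [xi0 [f0 xi0E [f0A f0N]]] := square_summable_positive Gc.
(* Applied to [xi0], [gap] produces an element of [S0]. The vector [xi0] is non-zero, since
   otherwise [A] would be empty and carry no mean. *)
have S_gt0 : 1 <= (size S)%:R :> R.
  suff [s sS _] : exists2 s, s \in S0 &
      l2norm (left_regular s xi0 + xi0) <= (2 - delta) * l2norm xi0.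
    by rewrite ler1n size_cat; case: (S0) sS.
  apply: gap => [x /f0N fx|]; first by rewrite xi0E fx.
  apply/eqP => /l2norm_eq0 E; suff : m (fun=> 1) <= m (fun=> 0).
    by rewrite !(mean_on_cst mA) lt_geF.
  apply: (mean_on_le mA) => [||x /f0A]; try exact: bounded_const.
  by have := xi0E x; rewrite E => -[<-]; rewrite ltxx.
have rho0 : 0 <= 2 * (size S)%:R - delta by lra.
(* Half of the gap makes this inequality strict; the other half survives once the [size S] copies of
   [u x] are removed from the supersolution. *)
have rho_theta : 2 * (size S)%:R - delta < 2 * (size S)%:R - delta / 2 by lra.
have [u [u0 uN uS]] := supersolution SA rho0 rho_theta averaging_le xi0E f0A
  f0N.
apply: (@no_supersolution m S0 (delta / 2) u) => //; first by rewrite divr_gt0.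
move=> x Ax; have := uS x.
rewrite big_split/= sum_const_seq -/S; lra.
Qed.

End Kesten.

(** * Ideals of the reduced algebra *)

Section OperatorNorm.
Local Open Scope classical_set_scope.
Local Open Scope ring_scope.
Variables (R : realType) (G : groupType).
Local Notation l2 := (l2 R G).
Implicit Types (xi eta zeta : l2) (g h x : G) (A B : l2 -> l2) (S : set (l2 ->
  l2)).

Definition norm_bound A (C : R) := forall xi, l2norm (A xi) <= C * l2norm xi.

Lemma opnorm_le A (C : R) : norm_bound A C -> 0 <= C -> (opnorm A <= C%:E)%E.
Proof.
move=> AC C0; apply: ge_ereal_sup => _ [xi /= xi1 <-].
by rewrite lee_fin (le_trans (AC xi))// -[leRHS]mulr1 ler_wpM2l.
Qed.

Lemma linear_zero A : linear A -> A 0 = 0.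
Proof. by move=> Al; have := Al (-1) 0 0;
  rewrite scaler0 addr0 scaleN1r addNr. Qed.

Lemma linear_scale A (a : R[i]) xi : linear A -> A (a *: xi) = a *: A xi.
Proof. by move=> Al; have := Al a xi 0;
  rewrite !addr0 (linear_zero Al) addr0. Qed.

Lemma linear_sub A xi eta : linear A -> A (xi - eta) = A xi - A eta.
Proof. by move=> Al; rewrite addrC -scaleN1r Al scaleN1r addrC. Qed.

Lemma norm_bound_opnorm A (C : R) : linear A -> (opnorm A <= C%:E)%E ->
  norm_bound A C.
Proof.
move=> Al AC xi; have [xi0|xi0] := eqVneq (l2norm xi) 0.
  by rewrite xi0 mulr0 (l2norm_eq0 xi0) (linear_zero Al) l2norm0.
have n0 : 0 < l2norm xi by rewrite lt_neqAle eq_sym xi0 l2norm_ge0.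
pose c : R[i] := ((l2norm xi)^-1)%:C%C.
have cn : normc c = (l2norm xi)^-1.
  by rewrite /= expr0n addr0 sqrtr_sqr ger0_norm// invr_ge0 ltW.
have : ((l2norm (A (c *: xi)))%:E <= C%:E)%E.
  apply: le_trans AC; apply: ereal_sup_ubound; exists (c *: xi) => //=.
  by rewrite l2normZ cn mulVf.
by rewrite lee_fin linear_scale// l2normZ cn mulrC ler_pdivrMr.
Qed.

Lemma bounded_operatorP A : bounded_operator A <->
  linear A /\ exists2 C, 0 <= C & norm_bound A C.
Proof.
split=> [[Al Ab]|[Al [C C0 AC]]].
  split=> //; exists (fine (opnorm A)).
    by rewrite fine_ge0//; apply: ereal_sup_ubound; exists 0;
      rewrite /= ?(linear_zero Al) l2norm0.
  apply: norm_bound_opnorm => //; rewrite fineK// ge0_fin_numE//.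
  by apply: ereal_sup_ubound; exists 0; rewrite /= ?(linear_zero Al) l2norm0.
by split=> //; apply: le_lt_trans (opnorm_le AC C0) _; rewrite ltry.
Qed.

Lemma linear_add A B : linear A -> linear B -> linear (A + B).
Proof.
move=> Al Bl a xi eta; rewrite -[LHS]/(A (a *: xi + eta) + B (a *: xi + eta)) Al
  Bl.
by rewrite -[(A + B) xi]/(A xi + B xi) -[(A + B) eta]/(A eta + B eta) scalerDr
  addrACA.
Qed.

Lemma linear_scale_op (c : R[i]) A : linear A -> linear (c *: A).
Proof.
move=> Al a xi eta; rewrite -[LHS]/(c *: A (a *: xi + eta)) Al.
by rewrite -[(c *: A) xi]/(c *: A xi) -[(c *: A) eta]/(c *: A eta) scalerDr
  !scalerA mulrC.
Qed.

Lemma linear_comp A B : linear A -> linear B -> linear (A \o B).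
Proof. by move=> Al Bl a xi eta; rewrite /= Bl Al. Qed.

Lemma bounded_operatorD A B :
  bounded_operator A -> bounded_operator B -> bounded_operator (A + B).
Proof.
move=> /bounded_operatorP[Al [C C0 AC]] /bounded_operatorP[Bl [D D0 BD]].
apply/bounded_operatorP; split; first exact: linear_add.
exists (C + D) => [|xi]; first exact: addr_ge0.
by rewrite (le_trans (l2normD _ _))// mulrDl lerD.
Qed.

Lemma bounded_operatorZ (a : R[i]) A : bounded_operator A ->
  bounded_operator (a *: A).
Proof.
move=> /bounded_operatorP[Al [C C0 AC]].
apply/bounded_operatorP; split; first exact: linear_scale_op.
exists (normc a * C) => [|xi]; first by rewrite mulr_ge0// normc_ge0.
by rewrite [l2norm _]l2normZ -mulrA ler_wpM2l// normc_ge0.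
Qed.

Lemma bounded_operator_comp A B :
  bounded_operator A -> bounded_operator B -> bounded_operator (A \o B).
Proof.
move=> /bounded_operatorP[Al [C C0 AC]] /bounded_operatorP[Bl [D D0 BD]].
apply/bounded_operatorP; split; first exact: linear_comp.
exists (C * D) => [|xi]; first exact: mulr_ge0.
by rewrite (le_trans (AC _))// -mulrA ler_wpM2l.
Qed.

Lemma bounded_operator0 : bounded_operator (0 : l2 -> l2).
Proof.
apply/bounded_operatorP; split=> [a xi eta|]; first by rewrite /= scaler0 addr0.
by exists 0 => // xi; rewrite mul0r l2norm0.
Qed.

Lemma norm_closureP S A : (forall B, S B -> bounded_operator B) ->
  norm_closure S A <-> bounded_operator A /\
    forall e : R, 0 < e -> exists2 B, S B & norm_bound (A - B) e.
Proof.
move=> Sb; split=> -[Ab AS]; split=> // e e0.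
  have [B SB AB] := AS e e0; exists B => //; apply: norm_bound_opnorm (ltW AB).
  rewrite -scaleN1r; apply: linear_add Ab.1 _; apply: linear_scale_op.
  exact: (Sb B SB).1.
have [B SB AB] := AS (e / 2) (divr_gt0 e0 (ltr0Sn _ _)); exists B => //.
apply: le_lt_trans (opnorm_le AB _) _; first by rewrite divr_ge0// ltW.
by rewrite lte_fin ltr_pdivrMr// ltr_pMr// ltr1n.
Qed.

Lemma sub_norm_closure S A : (forall B, S B -> bounded_operator B) ->
  S A -> norm_closure S A.
Proof.
move=> Sb SA; apply/norm_closureP => //; split=> [|e e0]; first exact: Sb.
exists A => // xi; rewrite -[(A - A) xi]/(A xi - A xi) subrr l2norm0.
by rewrite mulr_ge0 ?l2norm_ge0 ?(ltW e0).
Qed.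

Lemma norm_closure_bounded S A : norm_closure S A -> bounded_operator A.
Proof. by case. Qed.

Lemma norm_closureD S A B : (forall B, S B -> bounded_operator B) ->
  (forall A B, S A -> S B -> S (A + B)) ->
  norm_closure S A -> norm_closure S B -> norm_closure S (A + B).
Proof.
move=> Sb SD /(norm_closureP _ Sb)[Ab AS] /(norm_closureP _ Sb)[Bb BS].
apply/(norm_closureP _ Sb); split=> [|e e0];
  first exact: (bounded_operatorD Ab Bb).
have e2 : 0 < e / 2 by rewrite divr_gt0.
have [A' SA' AA'] := AS _ e2; have [B' SB' BB'] := BS _ e2.
exists (A' + B'); first exact: SD.
move=> xi; rewrite -[(_ - _) xi]/((A xi + B xi) - (A' xi + B' xi)) opprD
  addrACA.
rewrite (le_trans (l2normD _ _))//.
have := AA' xi; have := BB' xi.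
rewrite -[(A - A') xi]/(A xi - A' xi) -[(B - B') xi]/(B xi - B' xi); lra.
Qed.

Lemma norm_closureZ S (a : R[i]) A : (forall B, S B -> bounded_operator B) ->
  (forall B, S B -> S (a *: B)) -> norm_closure S A -> norm_closure S (a *: A).
Proof.
move=> Sb SZ /(norm_closureP _ Sb)[Ab AS].
apply/(norm_closureP _ Sb); split=> [|e e0];
  first exact: (bounded_operatorZ a Ab).
have a0 : 0 < normc a + 1 by rewrite ltr_wpDl// normc_ge0.
have [B SB AB] := AS _ (divr_gt0 e0 a0).
exists (a *: B); first exact: SZ.
move=> xi; rewrite -[(_ - _) xi]/(a *: A xi - a *: B xi) -scalerBr l2normZ.
have := AB xi; rewrite -[(A - B) xi]/(A xi - B xi) => le.
rewrite (le_trans (ler_wpM2l (normc_ge0 a) le))// mulrA ler_wpM2r ?l2norm_ge0//.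
rewrite mulrA ler_pdivrMr// mulrC ler_wpM2l ?(ltW e0)// lerDl.
exact: ler01.
Qed.

(** [A B - A' B' = (A - A') B + A' (B - B')]. The tolerance for [B'] depends on a bound [D] of [A'],
    so [A'] is chosen first; the [+ 1] avoids dividing by zero. *)
Lemma norm_closure_comp S1 S2 S3 A B :
  (forall B, S1 B -> bounded_operator B) -> (forall B, S2 B ->
    bounded_operator B) ->
  (forall B, S3 B -> bounded_operator B) ->
  (forall A B, S1 A -> S2 B -> S3 (A \o B)) ->
  norm_closure S1 A -> norm_closure S2 B -> norm_closure S3 (A \o B).
Proof.
move=> b1 b2 b3 S12 /(norm_closureP _ b1)[Ab AS] /(norm_closureP _ b2)[Bb BS].
apply/(norm_closureP _ b3); split=> [|e e0];
  first exact: (bounded_operator_comp Ab Bb).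
have /bounded_operatorP[_ [C C0 BC]] := Bb.
have [A' SA' AA'] : exists2 A', S1 A' & norm_bound (A - A') (e / 2 / (C + 1)).
  by apply: AS; rewrite divr_gt0 ?divr_gt0// ltr_wpDl.
have /bounded_operatorP[A'l [D D0 A'D]] := b1 A' SA'.
have [B' SB' BB'] : exists2 B', S2 B' & norm_bound (B - B') (e / 2 / (D + 1)).
  by apply: BS; rewrite divr_gt0 ?divr_gt0// ltr_wpDl.
exists (A' \o B'); first exact: S12.
move=> xi; rewrite -[(_ - _) xi]/(A (B xi) - A' (B' xi)).
rewrite -(subrK (A' (B xi)) (A (B xi))) -addrA -linear_sub//.
rewrite (le_trans (l2normD _ _))//.
have h1 := AA' (B xi); rewrite -[(A - A') _]/(A (B xi) - A' (B xi)) in h1.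
have h2 := BB' xi; rewrite -[(B - B') _]/(B xi - B' xi) in h2.
have h3 := A'D (B xi - B' xi).
have half (E : R) : 0 <= E -> e / 2 / (E + 1) * E <= e / 2.
  move=> E0; rewrite mulrAC ler_pdivrMr ?ltr_wpDl//
    ler_wpM2l ?divr_ge0 ?(ltW e0)//.
  by rewrite lerDl.
apply: (@le_trans _ _ (e / 2 * l2norm xi + e / 2 * l2norm xi)); last first.
  by rewrite -mulrDl -mulrDr mulrC; lra.
apply: lerD.
  apply: le_trans h1 _; apply: le_trans (ler_wpM2r (l2norm_ge0 xi) (half C C0)).
  have pos : 0 <= e / 2 / (C + 1).
    by rewrite divr_ge0 ?addr_ge0 ?divr_ge0 ?(ltW e0).
  by apply: le_trans (ler_wpM2l pos (BC xi)) _; rewrite mulrA.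
apply: le_trans h3 _; apply: le_trans (ler_wpM2l D0 h2) _.
by rewrite mulrA ler_wpM2r ?l2norm_ge0// mulrC half.
Qed.

Lemma norm_closure_idem S : (forall B, S B -> bounded_operator B) ->
  norm_closure (norm_closure S) `<=` norm_closure S.
Proof.
move=> Sb A /(norm_closureP _ (@norm_closure_bounded S))[Ab AS].
apply/(norm_closureP _ Sb); split=> // e e0.
have e2 : 0 < e / 2 by rewrite divr_gt0.
have [B /(norm_closureP _ Sb)[_ BS] AB] := AS _ e2.
have [D SD BD] := BS _ e2; exists D => // xi.
rewrite -[(_ - _) xi]/(A xi - D xi) -(subrK (B xi) (A xi)) -addrA.
rewrite (le_trans (l2normD _ _))//.
have := AB xi; have := BD xi.
rewrite -[(A - B) xi]/(A xi - B xi) -[(B - D) xi]/(B xi - D xi); lra.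
Qed.

Definition convolution (s : seq (R[i] * G)) : l2 -> l2 :=
  \sum_(p <- s) p.1 *: (left_regular p.2 : l2 -> l2).

Lemma convolutionE s xi : convolution s xi = \sum_(p <- s) p.1 *: left_regular
  p.2 xi.
Proof.
rewrite /convolution; elim: s => [|p s IH]; first by rewrite !big_nil.
by rewrite !big_cons -IH.
Qed.

Lemma l2_sumE (I : Type) (s : seq I) (P : pred I) (f : I -> l2) x :
  (\sum_(i <- s | P i) f i) x = \sum_(i <- s | P i) f i x.
Proof.
by elim: s => [|i s IH]; rewrite ?big_nil// !big_cons; case: ifP; rewrite -IH.
Qed.

Lemma bounded_convolution s : bounded_operator (convolution s).
Proof.
rewrite /convolution; elim: s => [|p s IH].
  by rewrite big_nil; exact: bounded_operator0.
rewrite big_cons; apply: bounded_operatorD IH; apply: bounded_operatorZ.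
apply/bounded_operatorP; split; first exact: left_regular_linear.
by exists 1 => // xi; rewrite l2norm_left_regular mul1r.
Qed.

Lemma bounded_group_algebra A : group_algebra A -> bounded_operator A.
Proof. by move=> [s ->]; exact: bounded_convolution. Qed.

(** Translations span the group algebra, so stability under them makes [S] an algebraic ideal there,
    and continuity of the operations passes this to the closures. *)
Lemma closed_ideal S : S `<=` group_algebra (R := R) (G := G) -> S 0 ->
  (forall A B, S A -> S B -> S (A + B)) ->
  (forall a A, S A -> S (a *: A)) ->
  (forall g A, S A -> S (left_regular g \o A)) ->
  (forall g A, S A -> S (A \o left_regular g)) ->
  closed_two_sided_ideal (norm_closure S).
Proof.
move=> Salg S0 SD SZ Sl Sr.
have Sb B : S B -> bounded_operator B by move=> /Salg/bounded_group_algebra.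
have Smull A B : group_algebra A -> S B -> S (A \o B).
  move=> [s ->] SB; rewrite -/(convolution s).
  elim: s => [|p s IH]; first by rewrite /convolution big_nil.
  have -> : convolution (p :: s) \o B =
      (p.1 *: (left_regular p.2 \o B)) + (convolution s \o B).
    by rewrite /convolution big_cons.
  by apply: SD => //; apply: SZ; exact: Sl.
have Smulr A B : S A -> group_algebra B -> S (A \o B).
  move=> SA [s ->]; rewrite -/(convolution s); have Al := (Sb A SA).1.
  elim: s => [|p s IH].
    suff -> : A \o convolution [::] = 0 by [].
    by apply/funext => xi; rewrite /= convolutionE big_nil linear_zero.
  have -> : A \o convolution (p :: s) =
      (p.1 *: (A \o left_regular p.2)) + (A \o convolution s).
    apply/funext => xi.
    rewrite -[RHS]/(p.1 *: A (left_regular p.2 xi) + A (convolution s xi)) /=.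
    by rewrite !convolutionE big_cons Al.
  by apply: SD => //; apply: SZ; exact: Sr.
split.
- move=> A /(norm_closureP _ Sb)[Ab AS].
  apply/(norm_closureP _ bounded_group_algebra);
    split=> // e /AS[B /Salg SB AB].
  by exists B.
- exact: sub_norm_closure.
- by move=> A B; exact: norm_closureD.
- by move=> a A; apply: norm_closureZ => //; exact: SZ.
- by move=> A B; apply: norm_closure_comp => //; exact: bounded_group_algebra.
- by move=> A B; apply: norm_closure_comp => //; exact: bounded_group_algebra.
- exact: norm_closure_idem.
Qed.

End OperatorNorm.

(** * The ideal generated by [(1 - g1) (1 - g2)] *)

Section KernelIdeal.
Local Open Scope classical_set_scope.
Local Open Scope ring_scope.
Variables (R : realType) (G : groupType) (A : set G) (g1 g2 : G).
Hypothesis A_inv : forall x y, A x -> (A (x^-1 * y)%g <-> A y).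
Hypotheses (G_countable : countable [set: G]) (A_amenable : amenable_on R A).
Hypotheses (g1N1 : g1 != 1%g) (g2N1 : g2 != 1%g) (g12 : (g1 * g2 = g2 * g1)%g).
Hypothesis A_conj : forall k, A (k^-1 * g1 * k)%g \/ A (k^-1 * g2 * k)%g.
Local Notation l2 := (l2 R G).
Implicit Types (s : seq (R[i] * (G * G))).

(* [a g (1 - g1) (1 - g2) k] as a formal combination of group elements. *)
Definition sandwich (p : R[i] * (G * G)) : seq (R[i] * G) :=
  let: (a, (g, k)) := p in
  [:: (a, g * k)%g; (- a, g * g1 * k)%g; (- a, g * g2 * k)%g;
    (a, g * (g1 * g2) * k)%g].

Definition sandwiches s := flatten [seq sandwich p | p <- s].

(** The algebraic two-sided ideal of the group algebra generated by [(1 - g1) (1 - g2)]; its norm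
    closure refutes simplicity. *)
Definition kernel_ideal : set (l2 -> l2) :=
  [set convolution (sandwiches s) | s in setT].

Lemma convolution_cat (s t : seq (R[i] * G)) :
  convolution (s ++ t) = convolution s + convolution t :> (l2 -> l2).
Proof. by rewrite /convolution big_cat. Qed.

Lemma kernel_ideal_closed : closed_two_sided_ideal (norm_closure kernel_ideal).
Proof.
have map_sandwich (f : R[i] * G -> R[i] * G) (h : R[i] * (G * G) ->
  R[i] * (G * G)) :
    (forall p, map f (sandwich p) = sandwich (h p)) ->
    forall s, map f (sandwiches s) = sandwiches (map h s).
  move=> fh s; rewrite /sandwiches map_flatten -!map_comp; congr flatten.
  by apply: eq_map => p /=; exact: fh.
apply: closed_ideal.
- by move=> _ [s _ <-]; exists (sandwiches s).
- by exists [::] => //; rewrite /convolution big_nil.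
- move=> _ _ [s _ <-] [t _ <-]; exists (s ++ t) => //.
  by rewrite /sandwiches map_cat flatten_cat convolution_cat.
- move=> a _ [s _ <-]; exists [seq (a * p.1, p.2) | p <- s] => //.
  rewrite -(map_sandwich (fun q => (a * q.1, q.2))).
    by rewrite /convolution big_map scaler_sumr; apply: eq_bigr => q _;
      rewrite scalerA.
  by case=> b [g k]; rewrite /= !mulrN.
- move=> h _ [s _ <-]; exists [seq (p.1, (h * p.2.1, p.2.2)%g) | p <- s] => //.
  rewrite -(map_sandwich (fun q => (q.1, h * q.2)%g)).
    apply/funext => xi; rewrite /= !convolutionE big_map.
    elim: (sandwiches s) => [|q r IH].
      by rewrite !big_nil (linear_zero (@left_regular_linear R G h)).
    by rewrite !big_cons left_regular_linear -IH left_regularM.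
  by case=> b [g k]; rewrite /= !mulgA.
- move=> h _ [s _ <-]; exists [seq (p.1, (p.2.1, p.2.2 * h)%g) | p <- s] => //.
  rewrite -(map_sandwich (fun q => (q.1, q.2 * h)%g)).
    apply/funext => xi; rewrite /= !convolutionE big_map.
    by apply: eq_bigr => q _; rewrite left_regularM.
  by case=> b [g k]; rewrite /= !mulgA.
Qed.

Lemma kernel_ideal_bounded B : kernel_ideal B -> bounded_operator B.
Proof. by move=> [s _ <-]; exact: bounded_convolution. Qed.

Definition delta1_fun (x : G) : R[i]^o := (x == 1%g)%:R.

Lemma delta1_square_summable : delta1_fun \in @square_summable R G.
Proof.
apply/asboolP; rewrite /sqnorm.
apply: (@le_lt_trans _ _ (\esum_(x in [set 1%g : G]) 1%:E)%E).
  rewrite [leRHS]esum_mkcond; apply: le_esum => x _;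
    rewrite in_set1 /delta1_fun.
  by case: eqP => _; rewrite ?normc1 ?normc0 ?expr1n ?expr0n.
by rewrite esum_set1 ?ltry// lee_fin.
Qed.

(** Applied to the point mass at 1 and evaluated at 1, the generator gives 1 or 2: the terms of [g1]
    and [g2] vanish there and that of [g1 * g2] adds 0 or 1. *)
Lemma kernel_ideal_nonzero : norm_closure kernel_ideal <> [set 0].
Proof.
pose b : l2 -> l2 := convolution (sandwiches [:: (1, (1%g, 1%g))]).
move=> I0; have : norm_closure kernel_ideal b.
  apply: (sub_norm_closure kernel_ideal_bounded).
  by exists [:: (1, (1%g, 1%g))].
rewrite I0 => /(congr1 (fun f : l2 -> l2 => f (L2 delta1_square_summable) 1%g)).
rewrite /b (_ : sandwiches _ = [:: (1, 1%g); (-1, g1); (-1, g2);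
  (1, (g1 * g2)%g)]).
  2: by rewrite /sandwiches /= !mul1g !mulg1.
rewrite convolutionE l2_sumE !big_cons big_nil !l2ZE !left_regularE l20E !mulg1.
rewrite -[val (L2 _)]/delta1_fun /delta1_fun invg1 eqxx.
rewrite !invg_eq1 (negbTE g1N1) (negbTE g2N1) !mulr0 !add0r addr0 !mul1r.
by case: (_ == _) => /eqP; rewrite ?addr0 ?oner_eq0// -natrD pnatr_eq0.
Qed.

Lemma A_inverse x : A x -> A x^-1%g.
Proof.
move=> Ax; have := (A_inv x Ax).2 Ax; rewrite mulVg => A1.
by have := (A_inv 1%g Ax).2 A1; rewrite mulg1.
Qed.

Lemma A_mulr x y : A y -> A (x * y)%g <-> A x.
Proof.
move=> Ay; split=> [Axy|Ax].
  have := (A_inv y^-1%g (A_inverse Axy)).2 (A_inverse Ay).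
  by rewrite invgK mulgK.
have := (A_inv y (A_inverse Ax)).2 Ay.
by rewrite invgK.
Qed.

(* The coefficient sum over [A] is the matrix coefficient at the base point of
   the quasi-regular representation on [G / A], which kills the ideal. *)
Lemma sum_sandwiches s : \sum_(q <- sandwiches s | `[< A q.2 >]) q.1 = 0.
Proof.
rewrite /sandwiches big_flatten big_map big1// => -[a [g k]] _ /=.
rewrite big_mkcond !big_cons big_nil /=.
have AM x y : A y -> `[< A (x * y)%g >] = `[< A x >].
  by move=> Ay; apply: asbool_equiv_eq; exact: A_mulr.
(* If [k^-1 * g1 * k] lies in [A], inserting [g1] just before [k] does not affect membership in [A];
   since [g1] and [g2] commute, the four coefficients cancel in pairs. The other case is
   symmetric. *)
have [Ak|Ak] := A_conj k.
  have -> : `[< A (g * g1 * k)%g >] = `[< A (g * k)%g >].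
    by rewrite -(AM (g * k)%g _ Ak) !mulgA mulgK.
  have -> : `[< A (g * (g1 * g2) * k)%g >] = `[< A (g * g2 * k)%g >].
    by rewrite g12 -(AM (g * g2 * k)%g _ Ak) !mulgA mulgK.
  by case: asbool; case: asbool; ring.
have -> : `[< A (g * g2 * k)%g >] = `[< A (g * k)%g >].
  by rewrite -(AM (g * k)%g _ Ak) !mulgA mulgK.
have -> : `[< A (g * (g1 * g2) * k)%g >] = `[< A (g * g1 * k)%g >].
  by rewrite -(AM (g * g1 * k)%g _ Ak) !mulgA mulgK.
by case: asbool; case: asbool; ring.
Qed.

(** Otherwise some [t] in the ideal has [|1 - t| <= 1/2]. For [zeta] supported in [A], restricting
    [(1 - t) zeta] to [A] leaves only coefficients in [A], which sum to 0; almost invariance then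
    keeps the restriction within [|zeta| / 4] of [zeta], which is a contradiction. *)
Lemma kernel_ideal_proper : norm_closure kernel_ideal <> reduced_Cstar_algebra
  (G := G) (R := R).
Proof.
move=> IE; have : norm_closure kernel_ideal id.
  rewrite IE; apply: (sub_norm_closure (@bounded_group_algebra R G)).
  exists [:: (1, 1%g)]; apply/funext => xi; rewrite big_seq1.
  by apply: l2E => x /=; rewrite -[RHS]/(1 * xi (1^-1 * x)%g) invg1 !mul1g
    mul1r.
have h2 : 0 < 2^-1 :> R by rewrite invr_gt0.
move=> /(norm_closureP _ kernel_ideal_bounded)[_ /(_ _ h2)[_ [s _ <-]]] near.
set t := sandwiches s in near.
pose C := \sum_(q <- t) normc q.1.
have C0 : 0 <= C by apply: sumr_ge0 => q _; exact: normc_ge0.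
(* Makes the total error [C * eps] at most 1/4, also when [C] is 0. *)
pose eps := (4 * (C + 1))^-1.
have eps0 : 0 < eps by rewrite invr_gt0 mulr_gt0// ltr_wpDl.
pose S := [seq q.2 | q <- t & `[< A q.2 >]].
have SA x : x \in S -> A x by move=> /mapP[q];
  rewrite mem_filter => /andP[/asboolP ? _] ->.
have [zeta [z0 zA zS]] := almost_invariant_vectors A_inv G_countable A_amenable
  SA eps0.
(* This is the restriction of [(1 - t) zeta] to [A]: subtracting [zeta] inside each term is free, as
   the coefficients over [A] sum to 0. *)
pose eta := zeta - \sum_(q <- t | `[< A q.2 >]) q.1 *: (left_regular q.2 zeta -
  zeta).
have E1 : l2norm eta <= 1 * l2norm ((id - convolution t) zeta).
  apply: l2norm_mono => // x; rewrite mul1r.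
  have [Ax|nAx] := pselect (A x).
    rewrite le_eqVlt; apply/orP; left; apply/eqP; congr normc.
    rewrite -[((id - _) zeta) x]/(zeta x - convolution t zeta x) l2DE l2NE.
    congr (_ - _); rewrite convolutionE !l2_sumE.
    have -> : \sum_(q <- t | `[< A q.2 >]) (q.1 *: (left_regular q.2 zeta -
      zeta)) x =
        \sum_(q <- t | `[< A q.2 >]) q.1 * zeta (q.2^-1 * x)%g -
        (\sum_(q <- t | `[< A q.2 >]) q.1) * zeta x.
      rewrite mulr_suml -sumrB; apply: eq_bigr => q _.
      by rewrite l2ZE l2DE l2NE left_regularE mulrBr.
    rewrite sum_sandwiches mul0r subr0 big_mkcond; apply: eq_bigr => q _.
    rewrite l2ZE left_regularE; case: asboolP => // nAq; rewrite zA ?mulr0//.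
    by move=> /(A_mulr _ Ax)/A_inverse; rewrite invgK.
  rewrite (_ : eta x = 0) ?normc0 ?normc_ge0//.
  rewrite l2DE l2NE zA// l2_sumE big1 ?subr0// => q /asboolP Aq.
  rewrite l2ZE l2DE l2NE left_regularE !zA ?subr0 ?mulr0//.
  by move/(A_inv _ Aq).
have E2 : l2norm zeta - l2norm eta <= 4^-1 * l2norm zeta.
  apply: le_trans (l2normB _ _) _; rewrite /eta opprB addrC subrK.
  rewrite -big_filter (le_trans (l2norm_sum _ _))//.
  apply: (@le_trans _ _ (C * eps * l2norm zeta)); last first.
    rewrite ler_wpM2r ?l2norm_ge0// /eps ler_pdivrMr ?mulr_gt0 ?ltr_wpDl//.
    by lra.
  rewrite /C -mulrA mulr_suml big_filter.
  rewrite [leRHS](bigID (fun q => `[< A q.2 >]))/= ler_wpDr//.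
    apply: sumr_ge0 => q _; rewrite mulr_ge0 ?normc_ge0//
      mulr_ge0 ?l2norm_ge0//.
    exact: ltW.
  rewrite big_seq_cond [leRHS]big_seq_cond; apply: ler_sum => q /andP[qt Aq].
  rewrite l2normZ ler_wpM2l ?normc_ge0// zS//.
  by apply/mapP; exists q => //; rewrite mem_filter Aq.
have := near zeta; have zpos :
  0 < l2norm zeta by rewrite lt_neqAle eq_sym z0 l2norm_ge0.
rewrite mul1r in E1; lra.
Qed.

Theorem not_Cstar_simple : ~ Cstar_simple R G.
Proof.
move=> /(_ _ kernel_ideal_closed)[/kernel_ideal_nonzero//|].
exact: kernel_ideal_proper.
Qed.

End KernelIdeal.

(** * Coloured trees *)

Section Words.
Variables (T : tree) (Omega : choiceType) (c : edge_coloring T Omega).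
Implicit Types (v w x y : T) (a b : Omega) (s t : seq Omega).
Local Notation nb := (neighbor c).

Lemma neighborK a : involutive (nb^~ a).
Proof.
move=> v; have := neighbor_color c (w := v) (v := nb v a).
by rewrite adj_sym adj_neighbor => /(_ isT);
  rewrite -color_sym ?adj_neighbor// color_neighbor.
Qed.

Lemma neighbor_inj v : injective (nb v).
Proof. by move=> a b /(congr1 (c v)); rewrite !color_neighbor. Qed.

Definition walk v s := foldl nb v s.

(** Each colour acts on the vertices as an involution, so these words spell the walks without
    backtracking. *)
Definition reduced s := sorted (fun a b => a != b) s.

Lemma walk_cat v s t : walk v (s ++ t) = walk (walk v s) t.
Proof. exact: foldl_cat. Qed.

Lemma walk_rcons v s a : walk v (rcons s a) = nb (walk v s) a.
Proof. by rewrite /walk foldl_rcons. Qed.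

Lemma walk_rev v s : walk (walk v s) (rev s) = v.
Proof.
elim: s v => [//|a s IH] v.
by rewrite rev_cons walk_rcons /= IH neighborK.
Qed.

Lemma reduced_rev s : reduced (rev s) = reduced s.
Proof.
rewrite /reduced rev_sorted; case: s => //= a s.
by apply: eq_path => x y; rewrite eq_sym.
Qed.

Lemma reduced_cat s a t :
  reduced (s ++ a :: t) = reduced (rcons s a) && reduced (a :: t).
Proof. by case: s => [|b s] //=; rewrite cat_path rcons_path /= andbA. Qed.

Lemma reduced_rcons s a b :
  reduced (rcons (rcons s a) b) = reduced (rcons s a) && (a != b).
Proof. by rewrite -!cats1 -catA /= reduced_cat cats1 /= andbT. Qed.

Lemma reduced_belast s a : reduced (rcons s a) -> reduced s.
Proof. by case: s => //= b s; rewrite rcons_path => /andP[]. Qed.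

(** Induction on the length. If the vertices are distinct, the walk is a cycle and acyclicity leaves
    lengths 1 and 2: a loop, or one edge travelled twice. A repeated vertex cuts out a shorter
    closed walk. *)
Lemma reduced_closed_walk v s : reduced s -> walk v s = v -> s = [::].
Proof.
have [n] := ubnP (size s); elim: n => // n IH in s v *.
case: s => [//|a s] /= sn sR sC; exfalso.
set s' := a :: s in sR sC.
pose p := scanl nb v s'.
have pP : path.path (@adj T) v p.
  rewrite /p; elim: s' v {sC p sR} => //= b t IHt v.
  by rewrite adj_neighbor IHt.
have sp : size p = (size s).+1 by rewrite size_scanl.
have lp : last v p = v.
  by rewrite /p -[RHS]sC -[RHS]/(walk v s'); elim: s' v {pP p sC sp sR} => /=.
have [Up|] := boolP (uniq p).
  have : (size p <= 2)%N.
    apply: tree_acyclic; rewrite /ucycle Up andbT.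
    case: p pP lp {sp Up} => //= x p /andP[vx xp] lp.
    by rewrite rcons_path xp lp.
  rewrite sp; case: (s) @s' sR sC {p pP sp lp Up sn} => [|b [|//]] /= .
    by move=> _ va _; have := adj_neighbor c v a; rewrite va adj_irr.
  rewrite andbT => ab; rewrite -[RHS](neighborK a) => /neighbor_inj ba.
  by rewrite ba eqxx in ab.
move=> /(uniqPn v)[i [j [ij jp]]].
have js : (j < size s')%N by rewrite /= -sp.
rewrite !nth_scanl ?(ltn_trans ij)// => eij.
(* The entry of index [i] in [p] is the vertex after [i.+1] letters, since [scanl] omits the start;
   [u] spells the walk between the two visits. *)
pose u := take (j - i) (drop i.+1 s').
have uE : take j.+1 s' = take i.+1 s' ++ u.
  by rewrite -takeD addSn subnKC// ltnW.
have szu : size u = (j - i)%N.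
  by rewrite size_takel// size_drop /= subSS leq_sub2r// -ltnS -sp.
suff : u = [::] by move/(congr1 size); rewrite szu /=; move: ij; lia.
apply: (IH u (walk v (take i.+1 s'))).
- by rewrite szu; move: sn js => /=; lia.
- by rewrite /u; apply: take_sorted; apply: drop_sorted.
- by rewrite -walk_cat -uE.
Qed.

(** Equal last letters are stripped; when the last letters differ, [s] followed by [rev t] is a
    reduced closed walk. *)
Lemma walk_inj v s t : reduced s -> reduced t -> walk v s = walk v t -> s = t.
Proof.
elim/last_ind: s t => [|s a IH] t.
  by move=> _ tR /= /esym /reduced_closed_walk ->.
elim/last_ind: t => [|t b _] sR tR.
  by move/reduced_closed_walk; exact.
have [<-|ab] := eqVneq a b.
  rewrite !walk_rcons => /(can_inj (neighborK a)).
  by move/IH => -> //; [move: sR|move: tR]; exact: reduced_belast.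
move=> st; suff : rcons s a ++ rev (rcons t b) = [::] by case: (s).
apply: (@reduced_closed_walk v); last by rewrite walk_cat st walk_rev.
rewrite rev_rcons reduced_cat reduced_rcons sR ab /=.
by rewrite -[X in is_true X]/(reduced (b :: rev t)) -rev_rcons reduced_rev.
Qed.

(** Connectedness gives some walk. Its letters are appended one at a time, a letter equal to the
    current last one cancelling it. *)
Lemma word_exists v x : exists s, reduced s /\ walk v s = x.
Proof.
have [p vp <-] := tree_connected v x.
have [s ->] : exists s, last v p = walk v s.
  elim: p v vp => [|y p IH] v /=; first by exists [::].
  by move=> /andP[vy /IH[s ->]]; exists (c v y :: s); rewrite /= neighbor_color.
elim/last_ind: s => [|s a [t [tR tE]]]; first by exists [::].
rewrite walk_rcons -tE; case/lastP: t tR {tE} => [|t b] tR.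
  by exists [:: a].
have [->|ab] := eqVneq b a; last first.
  by exists (rcons (rcons t b) a); rewrite reduced_rcons tR ab walk_rcons.
exists t; rewrite walk_rcons neighborK; split=> //.
exact: reduced_belast tR.
Qed.

Definition word v x : seq Omega := projT1 (cid (word_exists v x)).

Lemma word_reduced v x : reduced (word v x).
Proof. by rewrite /word; case: cid => s []. Qed.

Lemma walk_word v x : walk v (word v x) = x.
Proof. by rewrite /word; case: cid => s []. Qed.

Lemma word_walk v s : reduced s -> word v (walk v s) = s.
Proof. by move=> sR; apply: walk_inj (walk_word _ _) => //;
  exact: word_reduced. Qed.

Lemma word_unique v x s : reduced s -> walk v s = x -> word v x = s.
Proof. by move=> sR <-; exact: word_walk. Qed.

Lemma wordxx v : word v v = [::]. Proof. exact: word_unique. Qed.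

Lemma word_rev v x : word x v = rev (word v x).
Proof.
apply: word_unique; first by rewrite reduced_rev word_reduced.
by rewrite -{1}(walk_word v x) walk_rev.
Qed.

Lemma word_neighbor v x a :
  reduced (rcons (word v x) a) -> word v (nb x a) = rcons (word v x) a.
Proof. by move=> aR; apply: word_unique => //;
  rewrite walk_rcons walk_word. Qed.

Lemma word_neighbor_back v x a :
  ~~ reduced (rcons (word v x) a) -> word v x = rcons (word v (nb x a)) a.
Proof.
have := word_reduced v x; have := walk_word v x.
case/lastP: (word v x) => [//|s b] wx sR;
  rewrite reduced_rcons sR negbK => /eqP ba.
rewrite -ba; congr rcons; apply/esym/word_unique.
  exact: reduced_belast sR.
by rewrite -wx ba walk_rcons neighborK.
Qed.

Lemma tree_ind v0 (P : T -> Prop) : P v0 ->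
  (forall x b, reduced (rcons (word v0 x) b) -> P x -> P (nb x b)) ->
  forall x, P x.
Proof.
move=> P0 PS x; rewrite -(walk_word v0 x).
elim/last_ind: (word v0 x) (word_reduced v0 x) => [//|s b IH] sR.
have sR' := reduced_belast sR.
by rewrite walk_rcons; apply: PS; [rewrite word_walk|exact: IH].
Qed.

(** * Automorphisms with prescribed local actions *)

Section Portraits.
Variable sigma : T -> sym Omega.

(** The colour word of the image of a walk under an automorphism with local actions [sigma]. *)
Fixpoint trans v s := if s is a :: s' then sigma v a :: trans (nb v a) s' else
  [::].

Lemma size_trans v s : size (trans v s) = size s.
Proof. by elim: s v => //= a s IH v; rewrite IH. Qed.

Lemma trans_cat v s t : trans v (s ++ t) = trans v s ++ trans (walk v s) t.
Proof. by elim: s v => //= a s IH v; rewrite IH. Qed.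

Lemma trans_rcons v s a : trans v (rcons s a) = rcons (trans v s) (sigma (walk v
  s) a).
Proof. by rewrite -!cats1 trans_cat. Qed.

Lemma sym_inj (p : sym Omega) : injective (p : Omega -> Omega).
Proof. exact: can_inj (symK p). Qed.

Hypothesis sigma_compat : forall v a, sigma (nb v a) a = sigma v a.

Lemma reduced_trans v s : reduced s -> reduced (trans v s).
Proof.
elim: s v => //= a [|b s] IH v //= /andP[ab bs].
by rewrite -sigma_compat (inj_eq (@sym_inj _)) ab /=; exact: (IH (nb v a)).
Qed.

(** The vertex with word [s] from [v0] goes to the end of the transported walk from [w0].
    Compatibility along edges keeps reduced words reduced, which gives injectivity; surjectivity
    lifts a target word letter by letter. *)
Lemma portrait_aut v0 w0 : exists g : Aut T,
  g v0 = w0 /\ forall v, local_action c g v = sigma v.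
Proof.
pose f x := walk w0 (trans v0 (word v0 x)).
have f_nb x a : f (nb x a) = nb (f x) (sigma x a).
  have fr y b : reduced (rcons (word v0 y) b) ->
    f (nb y b) = nb (f y) (sigma y b).
    by move=> yb; rewrite /f word_neighbor// trans_rcons walk_rcons walk_word.
  have [/fr//|xa] := boolP (reduced (rcons (word v0 x) a)).
  have := fr (nb x a) a; rewrite -(word_neighbor_back xa) word_reduced =>
    /(_ isT).
  by rewrite neighborK sigma_compat => ->; rewrite neighborK.
have f_walk x s : f (walk x s) = walk (f x) (trans x s).
  by elim: s x => //= a s IH x; rewrite IH f_nb.
have f_inj : injective f.
  move=> x y fxy; rewrite -(walk_word x y).
  suff -> : word x y = [::] by [].
  have : trans x (word x y) = [::].
    apply: (@reduced_closed_walk (f x)); last by rewrite -f_walk walk_word fxy.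
    by apply: reduced_trans; exact: word_reduced.
  by case: word.
have f_surj y : exists x, f x = y.
  rewrite -(walk_word w0 y); elim/last_ind: (word w0 y) => [|t b [x xE]].
    by exists v0; rewrite /f wordxx.
  exists (nb x ((sigma x)^-1%g b)).
  by rewrite f_nb symVK xE walk_rcons.
have f_bij : bijective f.
  pose h y := projT1 (cid (f_surj y)).
  have hK : cancel h f by move=> y; rewrite /h; case: cid.
  by exists h => // x; apply: f_inj; rewrite hK.
have f_adj : to_sym f_bij \in @automorphism T.
  apply/asboolP => x y /=; apply/idP/idP => [xy|xy]; last first.
    by rewrite -(neighbor_color c xy) f_nb adj_neighbor.
  have := neighbor_color c xy.
  rewrite -[c (f x) (f y)](symVK (sigma x)) -f_nb => /f_inj <-.
  exact: adj_neighbor.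
exists (AutSym f_adj); split=> [|v]; first by rewrite /= /f wordxx.
by apply: symP => a /=; rewrite f_nb color_neighbor.
Qed.

End Portraits.

(** Local actions are assigned outwards from [v0]. The only constraint between a vertex and its
    predecessor is agreement at the colour of the joining edge, which the hypothesis on [next]
    guarantees. *)
Lemma portrait_grow v0 w0 (t0 : sym Omega) (next : T -> Omega -> sym Omega ->
  sym Omega) :
  (forall y b (t : sym Omega), next y b t b = t b) ->
  exists g : Aut T, [/\ g v0 = w0, local_action c g v0 = t0 &
    forall x b, reduced (rcons (word v0 x) b) ->
      local_action c g (nb x b) = next (nb x b) b (local_action c g x)].
Proof.
move=> nextE.
pose fix grow v (t : sym Omega) s :=
  if s is b :: s' then grow (nb v b) (next (nb v b) b t) s' else t.
have grow_rcons v (t : sym Omega) s b : grow v t (rcons s b) =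
    next (nb (walk v s) b) b (grow v t s).
  by elim: s v t => //= a s IH v t; rewrite IH.
pose sigma x := grow v0 t0 (word v0 x).
have sigma_nb x b : reduced (rcons (word v0 x) b) ->
    sigma (nb x b) = next (nb x b) b (sigma x).
  by move=> xb; rewrite /sigma word_neighbor// grow_rcons walk_word.
have sigmaE v a : sigma (nb v a) a = sigma v a.
  have [/sigma_nb->//|va] := boolP (reduced (rcons (word v0 v) a)).
  have := sigma_nb (nb v a) a.
  rewrite -(word_neighbor_back va) word_reduced neighborK => /(_ isT)->.
  by rewrite nextE.
have [g [g0 gE]] := portrait_aut sigmaE v0 w0.
exists g; split=> // [|x b xb]; first by rewrite gE /sigma wordxx.
by rewrite !gE sigma_nb.
Qed.

Section Action.
Implicit Types g h : Aut T.

Lemma local_action_compat g v a :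
  local_action c g (nb v a) a = local_action c g v a.
Proof.
rewrite -{2}(color_neighbor c v a) color_sym ?adj_neighbor//.
rewrite local_action_color; last by rewrite adj_sym adj_neighbor.
by rewrite color_sym// autP adj_sym adj_neighbor.
Qed.

Lemma aut_neighbor g v a : g (nb v a) = nb (g v) (local_action c g v a).
Proof. by rewrite /= neighbor_color// autP adj_neighbor. Qed.

Lemma aut_walk g v s : g (walk v s) = walk (g v) (trans (local_action c g) v s).
Proof. by elim: s v => // a s IH v; rewrite [walk _ _]/= IH aut_neighbor. Qed.

Lemma aut_word g v x : word (g v) (g x) = trans (local_action c g) v (word v x).
Proof.
apply: word_unique; last by rewrite -aut_walk walk_word.
by apply: reduced_trans; [exact: local_action_compat|exact: word_reduced].
Qed.

Lemma autE g h : g =1 h -> g = h.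
Proof. by move=> gh; apply/val_inj/symP. Qed.

End Action.
End Words.

(** * The groups G(F, F') *)

Section LocallyPrescribed.
Local Open Scope classical_set_scope.
Variables (T : tree) (Omega : choiceType) (c : edge_coloring T Omega).
Variables F F' : groupClosed (sym Omega).
Hypotheses (FF' : {subset F <= F'}) (Ffree : acts_freely F).
Hypothesis Forb : preserves_orbits F F'.
Local Notation Gamma := (group_of (GFF c F F')).
Local Notation nb := (neighbor c).
Local Notation word := (word c).
Implicit Types (v w x y : T) (a b : Omega) (g h k : Gamma) (s t : sym Omega).

Definition act g : T -> T := (val g : Aut T).

Definition sigma g v : sym Omega := local_action c (val g : Aut T) v.

Lemma free_eq s t a : s \in F -> t \in F -> s a = t a -> s = t.
Proof.
move=> sF tF st; suff /eqP : (t^-1 * s)%g \in trivial_subgroup (sym Omega).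
  by move/(congr1 (fun u => t * u)%g); rewrite mulgA mulgV mul1g mulg1.
rewrite -(Ffree a); apply/andP; split; first by rewrite gpredM ?gpredVr.
by rewrite symM st symK.
Qed.

Lemma free_fix s a : s \in F -> s a = a -> s = 1%g.
Proof. by move=> sF sa; apply: (@free_eq _ _ a) => //; rewrite gpred1. Qed.

Lemma orbit_rep s a : s \in F' -> exists2 f, f \in F & f a = s a.
Proof.
move=> sF'; have : orbit_of F a (s a).
  by apply: (Forb sF'); exists 1%g => //=; rewrite gpred1.
by case=> f; exists f.
Qed.

(** Preserved orbits provide an element of [F] with the same value at [a]. Outside [F'] the
    permutation itself serves, so that agreement at [a] is unconditional, as [portrait_grow]
    requires. *)
Lemma pick_exists s a : exists t : sym Omega,
  t a = s a /\ (s \in F' -> t \in F).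
Proof.
have [/(@orbit_rep _ a)[f fF fa]|sF'] := boolP (s \in F'); first by exists f.
by exists s.
Qed.

Definition pick_rep s a : sym Omega := projT1 (cid (pick_exists s a)).

Lemma pick_repE s a : pick_rep s a a = s a.
Proof. by rewrite /pick_rep; case: cid => t /= []. Qed.

Lemma pick_rep_in s a : s \in F' -> pick_rep s a \in F.
Proof. by move=> sF'; rewrite /pick_rep; case: cid => t /= [_]; exact. Qed.

Lemma sigma_in g v : sigma g v \in F'.
Proof. by rewrite /sigma; case: g => g /= /asboolP[]. Qed.

Lemma sigma_finite g : finite_set [set v | sigma g v \notin F].
Proof. by rewrite /sigma; case: g => g /= /asboolP[]. Qed.

Lemma GFF_intro (g : Aut T) (D : set T) : finite_set D ->
  (forall v, local_action c g v \in F') ->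
  (forall v, ~ D v -> local_action c g v \in F) ->
  exists h : Gamma, val h = g.
Proof.
move=> Dfin gF' gF; have gG : g \in GFF c F F'.
  apply/asboolP; split=> //; apply: sub_finite_set Dfin => v /= vF.
  by apply: contrapT => /gF; exact/negP.
by exists (GroupOf gG).
Qed.

Lemma actM g h v : act (g * h)%g v = act g (act h v). Proof. by []. Qed.
Lemma act1 v : act 1%g v = v. Proof. by []. Qed.
Lemma actK g : cancel (act g) (act g^-1)%g. Proof. exact: symK. Qed.
Lemma actVK g : cancel (act g^-1)%g (act g). Proof. exact: symVK. Qed.
Lemma act_inj g : injective (act g). Proof. exact: can_inj (actK g). Qed.
Lemma sigmaM g h v : sigma (g * h)%g v = (sigma g (act h v) * sigma h v)%g.
Proof. exact: local_actionM. Qed.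
Lemma sigma1 v : sigma 1%g v = 1%g.
Proof. exact: local_action1. Qed.
Lemma sigmaV g v : sigma (g^-1)%g v = ((sigma g (act g^-1 v))^-1)%g.
Proof. exact: local_actionV. Qed.

Lemma act_neighbor g v a : act g (nb v a) = nb (act g v) (sigma g v a).
Proof. exact: aut_neighbor. Qed.

Lemma sigma_compat g v a : sigma g (nb v a) a = sigma g v a.
Proof. exact: local_action_compat. Qed.

Lemma act_word g v x : word (act g v) (act g x) = trans c (sigma g) v (word v
  x).
Proof. exact: aut_word. Qed.

Lemma gammaE g h : act g =1 act h -> g = h.
Proof. by move=> gh; apply/val_inj/autE. Qed.

(* A vertex where the local action lies in [F] carries no information beyond
   that of its neighbours, because [F] acts freely. *)
Lemma gamma_rigid g h v0 : act g v0 = act h v0 -> sigma g v0 = sigma h v0 ->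
  (forall v, sigma g v = sigma h v \/ (sigma g v \in F /\ sigma h v \in F)) ->
  g = h.
Proof.
move=> gh0 s0 sF; apply: gammaE => v.
suff [] : act g v = act h v /\ sigma g v = sigma h v by [].
elim/(tree_ind (c := c) (v0 := v0)): v => // v b _ [ghv sv].
have ghb : act g (nb v b) = act h (nb v b).
  by rewrite !act_neighbor sv ghv.
split=> //; have [//|[gF hF]] := sF (nb v b).
by apply: (@free_eq _ _ b) => //; rewrite !sigma_compat sv.
Qed.

Lemma translation v w : exists2 g :
  Gamma, act g v = w & forall y, sigma g y = 1%g.
Proof.
have [//|g [gv g1]] := @portrait_aut _ _ c (fun=> 1%g) _ v w.
have [||y _|h hg] := @GFF_intro g set0; first exact: finite_set0.
- by move=> y; rewrite g1 gpred1.
- by rewrite g1 gpred1.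
- by exists h => [|y]; rewrite /act /sigma hg.
Qed.

(** The portrait grows from [s] at [v], each other vertex receiving an element of [F] that agrees
    with its predecessor on the joining edge. *)
Lemma spread_exists v s : s \in F' -> exists g : Gamma,
  [/\ act g v = v, sigma g v = s & forall w, w != v -> sigma g w \in F].
Proof.
move=> sF'.
have [g [gv gs gnext]] := @portrait_grow _ _ c v v s
  (fun _ b t => pick_rep t b) (fun _ b t => pick_repE t b).
have gF w : local_action c g w \in F' /\ (w != v -> local_action c g w \in F).
  elim/(tree_ind (c := c) (v0 := v)): w => [|w b wb [wF' _]].
    by rewrite gs eqxx.
  by rewrite gnext// pick_rep_in// FF'// pick_rep_in.
have [||w wv|h hg] := @GFF_intro g [set v]; first exact: finite_set1.
- by move=> w; have [] := gF w.
- by apply: (gF w).2; exact/eqP.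
- by exists h; rewrite /act /sigma hg; split=> // w /(gF w).2.
Qed.

Definition spread v (s : group_of F') : Gamma :=
  projT1 (cid (spread_exists v (valP s))).

(** * Elements with local action outside [F] at one vertex at most *)

Section Spread.
Implicit Types p q : group_of F'.

Lemma spread_fix v p : act (spread v p) v = v.
Proof. by rewrite /spread; case: cid => g /= []. Qed.

Lemma sigma_spread v p : sigma (spread v p) v = val p.
Proof. by rewrite /spread; case: cid => g /= []. Qed.

Lemma sigma_spread_in v p w : w != v -> sigma (spread v p) w \in F.
Proof. by rewrite /spread; case: cid => g /= [_ _]; exact. Qed.

Lemma spread_unique v p g : act g v = v -> sigma g v = val p ->
  (forall w, w != v -> sigma g w \in F) -> g = spread v p.
Proof.
move=> gv gs gF; apply: (@gamma_rigid _ _ v);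
  rewrite ?spread_fix ?sigma_spread// => w.
have [->|wv] := eqVneq w v; first by left; rewrite gs sigma_spread.
by right; rewrite gF// sigma_spread_in.
Qed.

Lemma spreadM v : {morph spread v : p q / (p * q)%g}.
Proof.
move=> p q; apply/esym/spread_unique => [||w wv].
- by rewrite actM !spread_fix.
- by rewrite sigmaM spread_fix !sigma_spread.
- rewrite sigmaM gpredM ?sigma_spread_in//.
  by rewrite -{2}(spread_fix v q) (inj_eq (@act_inj _)).
Qed.

(** The edge of colour [a] at [v] is fixed, so the local action at its far end is an element of [F]
    with a fixed point, hence trivial; this propagates along the branch. *)
Lemma spread_branch v p a x : val p a = a -> ohead (word v x) = Some a ->
  act (spread v p) x = x.
Proof.
move=> sa; rewrite -{-1}(walk_word c v x).
have := word_reduced c v x; case: (word v x) => [//|b r] br [ba].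
rewrite {b}ba in br *.
suff [] : act (spread v p) (walk c v (a :: r)) = walk c v (a :: r) /\
    sigma (spread v p) (walk c v (a :: r)) = 1%g by [].
elim/last_ind: r br => [|r b IH] br.
  have E : act (spread v p) (nb v a) = nb v a.
    by rewrite act_neighbor sigma_spread sa spread_fix.
  split=> //=; apply: (@free_fix _ a).
    apply: sigma_spread_in; apply/eqP => va; have := adj_neighbor c v a.
    by rewrite va adj_irr.
  by rewrite sigma_compat sigma_spread.
have [] := IH (@reduced_belast _ (a :: r) b br).
set y := walk c v (a :: r) => yE sy.
have yb : walk c v (a :: rcons r b) = nb y b by rewrite -rcons_cons walk_rcons.
have E : act (spread v p) (nb y b) = nb y b.
  by rewrite act_neighbor sy yE.
rewrite yb E; split=> //; apply: (@free_fix _ b).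
  apply: sigma_spread_in; apply/eqP => yv.
  have : a :: rcons r b = [::] by apply: (@reduced_closed_walk _ _ c v);
    rewrite ?yb.
  by [].
by rewrite sigma_compat sy.
Qed.

End Spread.

Lemma countable_vertices : countable [set: Omega] -> countable [set: T].
Proof.
move=> /countable_injP[f f_inj]; apply/countable_injP.
have {}f_inj : injective f by move=> a b; apply: f_inj; rewrite inE.
have [v0] := tree_inhabited T.
exists (fun v => pickle (map f (word v0 v))) => v w _ _ /(pcan_inj pickleK).
move=> /(inj_map f_inj) vw.
by rewrite -(walk_word c v0 v) vw walk_word.
Qed.

(** By [gamma_rigid], an element is determined by the image of [v0] and its local actions at [v0]
    and at the finitely many vertices where they leave [F]. *)
Lemma countable_gamma : countable [set: Omega] -> countable [set` F'] ->
  countable [set: Gamma].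
Proof.
move=> /countable_vertices/countable_injP[e e_inj] /countable_injP[e' e'_inj].
have {}e_inj : injective e by move=> a b; apply: e_inj; rewrite inE.
have e'_sigma g h v : e' (sigma g v) = e' (sigma h v) -> sigma g v = sigma h v.
  by apply: e'_inj; rewrite inE; exact: sigma_in.
have [v0] := tree_inhabited T.
have ex g : exists r : seq T, [set v | sigma g v \notin F] = [set` r].
  exact/finite_seqP/sigma_finite.
pose S g := projT1 (cid (ex g)).
have SE g v : v \notin S g -> sigma g v \in F.
  move=> vS; apply: contrapT => /negP vF.
  have : [set v | sigma g v \notin F] v by [].
  by rewrite (projT2 (cid (ex g))) /= (negbTE vS).
pose code g := [seq (e v, e' (sigma g v)) | v <- v0 :: S g].
have codeE g h v : code g = code h -> v \in v0 :: S g -> sigma g v = sigma h v.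
  move=> gh vS; have : (e v, e' (sigma g v)) \in code h.
    by rewrite -gh; apply/mapP; exists v.
  by case/mapP => w _ [/e_inj -> /e'_sigma].
apply/countable_injP.
exists (fun g => pickle (e (act g v0), code g)) =>
  g h _ _ /(pcan_inj pickleK) E.
have [/e_inj gh0 ghc] : e (act g v0) = e (act h v0) /\ code g = code h.
  by split; [exact: (congr1 fst E)|exact: (congr1 snd E)].
apply: (@gamma_rigid _ _ v0) => // [|v].
  by apply: codeE => //; rewrite mem_head.
have [vg|vg] := boolP (v \in S g).
  by left; apply: codeE => //; rewrite inE vg orbT.
have [vh|vh] := boolP (v \in S h).
  by left; apply/esym/codeE => //; rewrite inE vh orbT.
by right; split; exact: SE.
Qed.

(** The half-tree beyond the edge of colour [a] at [v], not containing [v]. *)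
Definition half v a : set T := [set x | ohead (word v x) = Some a].

Lemma word_cons v a x : reduced (a :: word (nb v a) x) ->
  word v x = a :: word (nb v a) x.
Proof. by move=> xR; apply: word_unique => //=;
  rewrite -[RHS](walk_word c (nb v a)). Qed.

Lemma half_compl v a : half (nb v a) a = ~` half v a.
Proof.
apply/seteqP; split => x; rewrite /half /=.
  case wx : (word (nb v a) x) => [//|b r] /= [ba]; rewrite {b}ba in wx.
  have rR := word_reduced c (nb v a) x; rewrite wx in rR.
  have -> : word v x = r.
    apply: word_unique; first exact: path_sorted rR.
    by rewrite -[RHS](walk_word c (nb v a)) wx /= neighborK.
  by case: r rR {wx} => [//|d r] /= /andP[ad _] [da]; rewrite da eqxx in ad.
move=> xv; case wx : (word (nb v a) x) => [|b r].
  by case: xv; rewrite (@word_cons v a x) ?wx.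
have [->//|ba] := eqVneq b a; case: xv; rewrite (@word_cons v a x) wx//=.
by rewrite eq_sym ba; have := word_reduced c (nb v a) x; rewrite wx.
Qed.

Lemma half_sub v a b : b != a -> half (nb v b) a `<=` half v b.
Proof.
move=> ba x; rewrite /half /= => xa; rewrite (@word_cons v b x)//.
have := word_reduced c (nb v b) x; case: word xa => //= _ r [->] ->.
by rewrite ba.
Qed.

(** The condition on [b] makes the walk from [v] through [w] to [x] reduced, so it starts with the
    first colour of the walk from [v] to [w], which is not [a]. *)
Lemma half_disjoint v w a b x : v <> w ->
  ohead (word v w) <> Some a -> ohead (word w v) <> Some b ->
  half v a x -> half w b x -> False.
Proof.
rewrite /half /= => vw wa vb xa xb.
case wx : (word w x) xb => [//|d r] /= [dE]; rewrite {d}dE in wx.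
have rR := word_reduced c w x; rewrite wx in rR.
have E : word v x = word v w ++ b :: r.
  apply: word_unique; last by rewrite walk_cat walk_word -wx walk_word.
  rewrite reduced_cat rR andbT.
  have := word_reduced c v w; move: vb; rewrite word_rev.
  case/lastP: (word v w) => [//|s d]; rewrite rev_rcons /= => db sR.
  by rewrite reduced_rcons sR; apply/eqP => db'; apply: db; rewrite db'.
move: xa wa; rewrite E; have := walk_word c v w.
by case: (word v w) => //= [/vw//|d s _ -> /(_ erefl)].
Qed.

Lemma half_act g v a x :
  half (act g v) (sigma g v a) (act g x) <-> half v a x.
Proof.
rewrite /half /mkset act_word; case: word => // b r.
by split=> [[]/(@sym_inj _ (sigma g v)) ->|[->]].
Qed.

(** * Triviality of amenable normal subgroups *)

Section Radical.
Local Open Scope ring_scope.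
Variables (R : realType).
Hypothesis third : forall a b : Omega, exists d, d != a /\ d != b.

(* Translations identify all half-trees of a given colour. If [M] moves [v], then
   one of them, hence each of them, is disjoint from some [M]-translate of
   itself and so has mass at most 1/2; as complements of half-trees are
   half-trees, they all have mass 1/2, but three of them are disjoint. *)
Lemma amenable_normal_trivial (M : groupClosed Gamma) :
  is_normal M -> amenable R (group_of M) ->
    {subset M <= trivial_subgroup Gamma}.
Proof.
move=> Mn [m mM] k0 k0M; apply/eqP/gammaE => v; rewrite act1.
apply: contrapT; set w := act k0 v => wv.
have mT : mean_on [set: group_of M] m.
  split=> [||f fb f0||g f _ fb].
  - exact: meanD mM.
  - exact: meanZ mM.
  - by apply: (mean_ge0 mM) => // x; exact: f0.
  - exact: mean1 mM.
  - exact: mean_invariant mM _ _ fb.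
pose one (B : set T) x : R := if `[< B x >] then 1 else 0.
pose mu (f : T -> R) := m (fun k : group_of M => f (act (val k) v)).
have b1 B : bounded_fun (fun k : group_of M => one B (act (val k) v)).
  by apply/bounded_funE; exists 1 => k; rewrite /one; case: asbool;
    rewrite ?normr0 ?normr1.
(* Two colours are avoided: the one leading from [v] to [w], and the preimage under [sigma k0 v] of
   the one leading from [w] to [v]. Then [half v a] and its image under [k0] face away from each
   other. *)
have [a [a1 a2]] : exists a, ohead (word v w) <> Some a /\
    ohead (word w v) <> Some (sigma k0 v a).
  case E1 : (word v w) => [|p ?]; first by case: wv;
    rewrite -(walk_word c v w) E1.
  case E2 : (word w v) => [|q ?]; first by case: wv;
    rewrite -(walk_word c w v) E2.
  have [a [ap aq]] := third p ((sigma k0 v)^-1%g q).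
  exists a; split => /= -[E]; first by rewrite E eqxx in ap.
  by rewrite E symK eqxx in aq.
have kdisj y : half v a y -> half v a (act k0 y) -> False.
  move=> ya yka; apply: (half_disjoint _ a1 a2 yka); first by move=> vw;
    apply: wv.
  exact/half_act.
have mu_half u : mu (one (half u a)) <= 2^-1.
  have [t tv t1] := translation v u.
  (* Conjugating [k0] by the translation from [v] to [u] carries the disjointness over to
     [half u a]; normality keeps the conjugate in [M]. *)
  pose k : group_of M := GroupOf (Mn _ (t^-1)%g k0M).
  have kE : val k = (t * (k0 * t^-1))%g by rewrite /= /conjg invgK.
  have kjE j y : act t^-1%g (act (val (k * j)%g) y) = act k0 (act t^-1%g (act
    (val j) y)).
    by have -> : val (k * j)%g = (val k * val j)%g by []; rewrite kE !actM actK.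
  have tE x : half u a x <-> half v a (act t^-1%g x).
    by have := half_act t v a (act t^-1%g x); rewrite actVK tv t1.
  suff : mu (one (half u a)) + mu (one (half u a)) <= 1 by lra.
  rewrite -{2}[mu _](mean_on_inv mT (a := k))// -(mean_onD mT)//; last first.
    exact: (bounded_comp (fun j => k * j)%g (b1 (half u a))).
  rewrite -(mean_on_cst mT 1); apply: (mean_on_le mT) => [||j _].
  - by apply: bounded_add => //;
    exact: (bounded_comp (fun j => k * j)%g (b1 (half u a))).
  - exact: bounded_const.
  - rewrite !/one; case: asboolP => [/tE uj|_]; case: asboolP => [/tE ukj|_];
    rewrite ?addr0 ?add0r//.
    by case: (kdisj _ uj); rewrite -kjE.
have mu_compl u : mu (one (half u a)) + mu (one (half (nb u a) a)) = 1.
  rewrite -(mean_onD mT)// half_compl -[RHS](mean_on_cst mT); congr m.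
  by apply/funext => j; rewrite !/one; do 2 case: asboolP => //;
    rewrite ?addr0 ?add0r.
have mu_eq u : mu (one (half u a)) = 2^-1.
  have := mu_half u; have := mu_half (nb u a); have := mu_compl u; lra.
have [b [ba _]] := third a a; have [d [da db]] := third a b.
have hd p q y : p != q -> half v p y -> half v q y -> False.
  by rewrite /half /= => pq -> [pq']; rewrite pq' eqxx in pq.
(* The half-trees of colour [a] at the neighbours through [b] and [d] lie in the branches [b] and
   [d] at [v], so the three are disjoint, while their masses add up to 3/2. *)
suff : mu (one (half v a)) + (mu (one (half (nb v b) a)) + mu (one (half (nb v
  d) a))) <= 1.
  by rewrite !mu_eq; lra.
rewrite -!(mean_onD mT)//; last exact: bounded_add.
rewrite -(mean_on_cst mT 1); apply: (mean_on_le mT) => [||j _].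
- by do 2 apply: bounded_add => //.
- exact: bounded_const.
- rewrite !/one; case: asboolP => [ja|_];
  case: asboolP => [/(half_sub ba) jb|_];
  case: asboolP => [/(half_sub da) jd|_]; rewrite ?addr0 ?add0r//;
  by case: notF; (case: (hd _ _ _ ba jb ja) || case: (hd _ _ _ da jd ja) ||
    case: (hd _ _ _ db jd jb)).
Qed.

End Radical.

(** * Edge stabilizers are amenable *)

Section EdgeStabilizer.
Variables (R : realType) (x0 : T) (a0 : Omega) (e : T -> nat).
Hypothesis e_inj : injective e.
Hypothesis stab_amenable : forall a, amenable R (group_of (stabilizer F' a)).

Definition edge_stab : set Gamma :=
  [set g | act g x0 = x0 /\ act g (nb x0 a0) = nb x0 a0].

Definition depth v := size (word x0 v).

(* The colour of the edge at [v] pointing towards the fixed edge, which is the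
   fixed edge itself at the root [x0]. *)
Definition parent v := last a0 (word x0 v).

Lemma edge_stab_color g : edge_stab g -> sigma g x0 a0 = a0.
Proof. by case=> gx; rewrite act_neighbor gx => /neighbor_inj. Qed.

Lemma edge_stabI g : act g x0 = x0 -> sigma g x0 a0 = a0 -> edge_stab g.
Proof. by move=> gx ga; split=> //; rewrite act_neighbor gx ga. Qed.

Lemma edge_stabM g h : edge_stab g -> edge_stab h -> edge_stab (g * h)%g.
Proof. by move=> [g1 g2] [h1 h2]; split; rewrite actM ?h1 ?h2. Qed.

Lemma edge_stabV g : edge_stab g -> edge_stab g^-1%g.
Proof. by move=> [g1 g2]; split; apply: (@act_inj g); rewrite actVK. Qed.

Lemma depth_act g v : edge_stab g -> depth (act g v) = depth v.
Proof.
case=> gx _; rewrite /depth -{1}gx act_word.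
exact: size_trans.
Qed.

Lemma depth_neighbor v a : (depth (nb v a) <= (depth v).+1)%N.
Proof.
rewrite /depth; have [va|va] := boolP (reduced (rcons (word x0 v) a)).
  by rewrite word_neighbor// size_rcons.
by rewrite [in leqRHS](word_neighbor_back va) size_rcons leqW.
Qed.

Lemma sigma_parent g v : edge_stab g ->
  (forall w, (depth w <= depth v)%N -> act g w = w) ->
    sigma g v (parent v) = parent v.
Proof.
rewrite /parent /depth => gE; have := word_reduced c x0 v;
  have := walk_word c x0 v.
case/lastP: (word x0 v) => [<- _ _|s b vE sR gfix];
  first exact: edge_stab_color.
rewrite last_rcons -vE walk_rcons sigma_compat.
have := gfix v; rewrite -{2 3}vE walk_rcons act_neighbor gfix.
  by rewrite -vE word_walk// => /(_ (leqnn _))/neighbor_inj.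
by rewrite word_walk ?(reduced_belast sR)// size_rcons.
Qed.

(* [level n.+1] is [level n] times its normal subgroup [layer n], and [layer n]
   is the direct sum of the groups [local_stab v] over the vertices [v] of depth
   [n]. *)
Definition level n : set Gamma :=
  [set g | edge_stab g /\ forall v, (n <= depth v)%N -> sigma g v \in F].

Lemma levelM n g h : level n g -> level n h -> level n (g * h)%g.
Proof.
move=> [gE gF] [hE hF]; split=> [|v nv]; first exact: edge_stabM.
by rewrite sigmaM gpredM ?hF ?gF ?depth_act.
Qed.

Lemma levelV n g : level n g -> level n g^-1%g.
Proof.
move=> [gE gF]; split=> [|v nv]; first exact: edge_stabV.
by rewrite sigmaV gpredVr// gF// depth_act//; exact: edge_stabV.
Qed.

Lemma level_homo : {homo level : n p / (n <= p)%N >-> n `<=` p}.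
Proof. by move=> n p np g [gE gF]; split=> // v /(leq_trans np); exact: gF. Qed.

Lemma edge_stab_free g : edge_stab g -> (forall v, sigma g v \in F) -> g = 1%g.
Proof.
move=> gE gF; apply: (@gamma_rigid _ _ x0).
- by rewrite gE.1.
- by rewrite sigma1; apply: (@free_fix _ a0) => //; exact: edge_stab_color.
- by move=> v; right; rewrite sigma1 gpred1.
Qed.

Lemma edge_stab1 : edge_stab 1%g. Proof. by []. Qed.

Lemma level0 : level 0 = [set 1%g].
Proof.
apply/seteqP; split=> [g [gE gF]|_ ->] /=;
  first by apply: edge_stab_free => // v; exact: gF.
by split=> [|v _]; [exact: edge_stab1|rewrite sigma1 gpred1].
Qed.

Definition layer n : set Gamma :=
  [set g | level n.+1 g /\ forall v, (depth v <= n)%N -> act g v = v].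

Lemma sigma_layer n g v : layer n g -> (depth v < n)%N -> sigma g v = 1%g.
Proof.
move=> [_ gfix] vn; apply: symP => a; apply: (@neighbor_inj _ _ c v).
rewrite -{1}(gfix v (ltnW vn)) -act_neighbor gfix//.
exact: leq_trans (depth_neighbor _ _) vn.
Qed.

Lemma sigma_layer_parent n g v : layer n g -> (depth v <= n)%N ->
  sigma g v (parent v) = parent v.
Proof.
move=> [[gE _] gfix] vn; apply: sigma_parent => // w wv.
by apply: gfix; exact: leq_trans vn.
Qed.

(** If the walk from [v] to [x] started away from the root, prefixing the walk from [x0] to [v]
    would give a reduced word, and [x] would be deeper than [v]. *)
Lemma word_parent v x : (depth x <= depth v)%N -> x <> v ->
  ohead (word v x) = Some (parent v).
Proof.
rewrite /depth /parent => xv nxv; apply: contrapT => vx.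
have rE : word v x != [::].
  by apply/eqP => E; apply: nxv; rewrite -(walk_word c v x) E.
suff E : word x0 x = word x0 v ++ word v x.
  by move: xv; rewrite E size_cat -{2}(addn0 (size _)) leq_add2l leqn0 size_eq0
    (negbTE rE).
apply: word_unique; last by rewrite walk_cat !walk_word.
have := word_reduced c v x; have := word_reduced c x0 v.
case: (word v x) vx rE => // b r /= br _;
  case/lastP: (word x0 v) xv br => // s d.
rewrite last_rcons => _ bd sR rR;
  rewrite reduced_cat reduced_rcons sR [reduced (b :: r)]rR andbT.
by apply/eqP => db; apply: bd; rewrite db.
Qed.

Definition stab_incl a (p : group_of (stabilizer F' a)) : group_of F' :=
  GroupOf (proj1 (andP (valP p))).

Lemma stab_inclE a p : val (@stab_incl a p) a = a.
Proof. by case: p => p /= /andP[_ /eqP]. Qed.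

(** A copy of the stabilizer of the colour [parent v] in [F'], acting at [v] and fixing what lies on
    the side of the fixed edge. *)
Definition local_stab v : set Gamma :=
  range (fun p => spread v (@stab_incl (parent v) p)).

Lemma amenable_local_stab v : amenable_on R (local_stab v).
Proof.
apply: amenable_on_image (stab_amenable (parent v)) => p q.
by rewrite -spreadM; congr spread; exact: val_inj.
Qed.

Lemma local_stab_fix v g x : local_stab v g -> (depth x <= depth v)%N ->
  act g x = x.
Proof.
move=> [p _ <-] xv; have [->|/eqP nxv] := eqVneq x v; first exact: spread_fix.
by apply: spread_branch (word_parent xv nxv); exact: stab_inclE.
Qed.

Lemma local_stab_layer v g : local_stab v g -> layer (depth v) g.
Proof.
move=> gv; have gfix := local_stab_fix gv; split=> [|//]; split=> [|w wv].
  split; first by apply: gfix; rewrite /depth wordxx.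
  have [vx0|vx0] := pselect (v = x0).
    have pv : sigma g v (parent v) = parent v.
      by case: gv => p _ <-; rewrite sigma_spread stab_inclE.
    have pa : parent v = a0 by rewrite vx0 /parent wordxx.
    by rewrite -vx0 -pa act_neighbor pv gfix.
  apply: gfix; apply: leq_trans (depth_neighbor _ _) _;
    rewrite /depth wordxx /=.
  by rewrite lt0n size_eq0; apply/eqP => E; apply: vx0;
    rewrite -(walk_word c x0 v) E.
case: gv => p _ <-; apply: sigma_spread_in; apply: contraTneq wv => ->.
by rewrite ltnn.
Qed.

Lemma local_stabI g v : edge_stab g -> act g v = v ->
  sigma g v (parent v) = parent v ->
  (forall w, w != v -> sigma g w \in F) -> local_stab v g.
Proof.
move=> gE gv gp gF.
have pS : sigma g v \in stabilizer F' (parent v).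
  by apply/andP; split; [exact: sigma_in|apply/eqP].
by exists (GroupOf pS) => //; apply/esym/spread_unique.
Qed.

(** The filtration of the layer along the enumeration [e], by which its summands are added one
    vertex at a time. *)
Definition partial_layer n j : set Gamma :=
  [set g | layer n g /\ forall v, (j <= e v)%N -> sigma g v \in F].

Lemma partial_layerM n j g h :
  partial_layer n j g -> partial_layer n j h -> partial_layer n j (g * h)%g.
Proof.
move=> [[gl gfix] gF] [[hl hfix] hF]; split; first split.
- exact: levelM.
- by move=> v vn; rewrite actM hfix// gfix.
- move=> v jv; rewrite sigmaM gpredM ?hF//.
  have [vn|vn] := leqP (depth v) n; first by rewrite hfix// gF.
  by apply: gl.2; rewrite depth_act//; exact: hl.1.
Qed.

Lemma partial_layer_homo n :
  {homo partial_layer n : j k / (j <= k)%N >-> j `<=` k}.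
Proof. by move=> j k jk g [gE gF]; split=> // v /(leq_trans jk); exact: gF. Qed.

(** Both elements fix the ball of radius [n], so local actions there are conjugated in place. At [v]
    that of [a] is trivial by freeness, at the other vertices of the ball that of [b] is; further
    out, all lie in [F]. *)
Lemma local_stab_commute n j v (a b : Gamma) : depth v = n -> e v = j ->
  partial_layer n j a -> local_stab v b -> local_stab v (a^-1 * b * a)%g.
Proof.
move=> vn vj [[[aE aF] afix] aj] bv.
have bl := local_stab_layer bv; have [[bE _] bfix] := bl; rewrite vn in bl bfix.
have afixV w : (depth w <= n)%N -> act a^-1%g w = w.
  by move=> wn; apply: (@act_inj a); rewrite actVK afix.
have a1 : sigma a v = 1%g.
  apply: (@free_fix _ (parent v)); first by apply: aj; rewrite vj.
  by apply: (@sigma_layer_parent n) => //; rewrite vn.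
have E w : (depth w <= n)%N ->
    sigma (a^-1 * b * a)%g w = ((sigma a w)^-1 * sigma b w * sigma a w)%g.
  move=> wn; rewrite !sigmaM sigmaV afix// bfix// afixV//.
have cE : edge_stab (a^-1 * b * a)%g.
  by apply: edge_stabM => //; apply: edge_stabM => //; exact: edge_stabV.
apply: local_stabI => //.
- by rewrite !actM afix ?vn// bfix ?vn// afixV ?vn.
- by rewrite E ?vn// a1 mulg1 invg1 mul1g (sigma_layer_parent bl)// vn.
- move=> w wv; have [wn|wn] := leqP (depth w) n.
    rewrite E//; have -> : sigma b w = 1%g.
      apply: (@free_fix _ (parent w)); last exact: (sigma_layer_parent bl).
      by case: bv => p _ <-; exact: sigma_spread_in.
    by rewrite mulg1 mulVg gpred1.
  have aV := edge_stabV aE.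
  rewrite !sigmaM sigmaV !gpredM ?gpredVr ?aF ?depth_act//.
  by apply: (bl.1).2; rewrite depth_act.
Qed.

Lemma amenable_partial_layer n j : amenable_on R (partial_layer n j).
Proof.
elim: j => [|j IH].
  rewrite (_ : partial_layer n 0 = [set 1%g]); first exact: amenable_on1.
  apply/seteqP; split=> [g [[[gE _] _] gF]|_ ->];
    first by apply: edge_stab_free => // v; exact: gF.
  split=> [|v _]; last by rewrite sigma1 gpred1.
  by split=> //; split=> [|v _]; [exact: edge_stab1|rewrite sigma1 gpred1].
(* Only a vertex of index [j] and depth exactly [n] adds a factor: in the layer, local actions are
   trivial closer to the root and lie in [F] further out. *)
have [[v [vj vn]]|nov] := pselect (exists v, e v = j /\ depth v = n);
  last first.
  rewrite (_ : partial_layer n j.+1 = partial_layer n j)//.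
  apply/seteqP; split=> g; last exact: partial_layer_homo.
  move=> [gl gF]; split=> // v; rewrite leq_eqVlt => /orP[/eqP jv|];
    last exact: gF.
  have [vn|vn|vn] := ltngtP (depth v) n; last by case: nov; exists v.
    by rewrite (sigma_layer gl)// gpred1.
  exact: (gl.1).2.
have vF g : local_stab v g -> partial_layer n j.+1 g.
  move=> gv; split=> [|w jw]; first by rewrite -vn; exact: local_stab_layer.
  case: gv => p _ <-; apply: sigma_spread_in; apply: contraTneq jw => ->.
  by rewrite vj ltnn.
rewrite (_ : partial_layer n j.+1 =
    [set (a * b)%g | a in partial_layer n j & b in local_stab v]).
  apply: amenable_on_mul IH (amenable_local_stab v) => a b.
  exact: local_stab_commute.
apply/seteqP; split=> [g gj|_ [a aj [b bv <-]]]; last first.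
  by apply: partial_layerM (vF _ bv); exact: partial_layer_homo aj.
have [gl gF] := gj; have gp : sigma g v \in stabilizer F' (parent v).
  apply/andP; split; first exact: sigma_in.
  by apply/eqP/(sigma_layer_parent gl); rewrite vn.
pose p : group_of (stabilizer F' (parent v)) := GroupOf gp.
pose s q := spread v (@stab_incl (parent v) q).
have sv q : local_stab v (s q) by exists q.
have sM : (s p^-1 * s p)%g = 1%g.
  rewrite /s -spreadM.
  have -> : (stab_incl p^-1 * stab_incl p)%g = 1%g by apply: val_inj;
    exact: mulVg.
  apply/esym/spread_unique => [||w _]; rewrite ?sigma1//.
  exact: gpred1.
(* The factor [s p] carries the local action of [g] at [v]; dividing it out leaves a trivial local
   action there. *)
exists (g * s p^-1)%g; last by exists (s p) => //; rewrite -mulgA sM mulg1.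
have [gl' gF'] := partial_layerM gj (vF _ (sv p^-1%g)).
split=> // w; rewrite leq_eqVlt => /orP[/eqP jw|]; last exact: gF'.
have -> : w = v by apply: e_inj; rewrite -jw vj.
rewrite sigmaM spread_fix sigma_spread.
have -> : (sigma g v * val (stab_incl p^-1))%g = 1%g by exact: mulgV.
exact: gpred1.
Qed.

Lemma amenable_layer n : amenable_on R (layer n).
Proof.
rewrite (_ : layer n = \bigcup_j partial_layer n j).
  apply: amenable_on_bigcup (amenable_partial_layer n).
  exact: partial_layer_homo.
apply/seteqP; split=> [g gl|g [j _ []//]].
have /finite_seqP[r rE] := sigma_finite g.
exists (\max_(v <- r) e v).+1 => //; split=> // v; apply: contraLR => vF.
rewrite -leqNgt (big_rem v)/=; first exact: leq_maxl.
by have : [set` r] v by rewrite -rE.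
Qed.

(** The portrait of [g] is copied at depth less than [n] and continued by elements of [F], so the
    ball of radius [n] is moved as before and no new vertex leaves [F]. *)
Lemma level_truncate n g : level n.+1 g -> exists2 k, level n k &
  forall v, (depth v <= n)%N -> act k v = act g v.
Proof.
move=> [gE gF].
(* At depth less than [n] the test on [b] always succeeds along the portrait being built; it makes
   [nextE] hold for arbitrary [t]. *)
pose next y b (t : sym Omega) :=
  if (depth y < n)%N && (sigma g y b == t b) then sigma g y else pick_rep t b.
have nextE y b (t : sym Omega) : next y b t b = t b.
  by rewrite /next; case: ifP => [/andP[_ /eqP]//|_]; exact: pick_repE.
(* For [n = 0] even the root must act through [F], hence the identity there. *)
have [k [kx0 k0 knext]] :=
  @portrait_grow _ _ c x0 x0 (if (0 < n)%N then sigma g x0 else 1%g) next nextE.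
have kP x : [/\ local_action c k x \in F',
    (depth x <= n)%N -> k x = act g x,
    (depth x < n)%N -> local_action c k x = sigma g x &
    (n <= depth x)%N -> local_action c k x \in F].
  elim/(tree_ind (c := c) (v0 := x0)): x => [|x b xb [kF' kx ks kF]].
    rewrite k0 /depth wordxx /=; split=> //.
    - by case: ifP => _; [exact: sigma_in|exact: gpred1].
    - by rewrite kx0 gE.1.
    - by move=> ->.
    - by rewrite leqn0 => /eqP->; exact: gpred1.
  have dE : depth (nb x b) = (depth x).+1.
    by rewrite /depth word_neighbor// size_rcons.
  rewrite knext// dE; split.
  - by rewrite /next; case: ifP => _; [exact: sigma_in|exact/FF'/pick_rep_in].
  - by move=> xn; rewrite (aut_neighbor c) act_neighbor kx ?ks// ltnW.
  - by move=> xn; rewrite /next dE xn sigma_compat ks ?eqxx// ltnW.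
  - by rewrite /next dE leqNgt => /negbTE-> /=; exact: pick_rep_in.
have [v|v vF|h hk] := @GFF_intro k _ (sigma_finite g).
- by have [] := kP v.
- have [_ _ ks kF] := kP v; have [vn|/kF//] := ltnP (depth v) n.
  by rewrite ks//; apply: contrapT => /negP.
have hE v : act h v = k v by rewrite /act hk.
have hs v : sigma h v = local_action c k v by rewrite /sigma hk.
exists h => [|v vn]; last by rewrite hE; have [_ ->] := kP v.
split=> [|v nv]; last by rewrite hs; have [_ _ _ ->] := kP v.
apply: edge_stabI; first by rewrite hE.
by rewrite hs k0; case: ifP => // _; exact: edge_stab_color.
Qed.

Lemma amenable_level n : amenable_on R (level n).
Proof.
elim: n => [|n IH]; first by rewrite level0; exact: amenable_on1.
rewrite (_ : level n.+1 = [set (k * m)%g | k in level n & m in layer n]).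
  apply: amenable_on_mul IH (amenable_layer n) => k m kn [mn mfix].
  have kn1 : level n.+1 k by exact: level_homo kn.
  split=> [|v vn]; first by apply: levelM => //; apply: levelM => //;
    exact: levelV.
  by rewrite !actM mfix ?actK// depth_act//; exact: kn.1.
apply/seteqP; split=> [g gn|_ [k kn [m mn <-]]]; last first.
  by apply: levelM mn.1; exact: level_homo kn.
have [k kn kg] := level_truncate gn; exists k => //.
exists (k^-1 * g)%g; last by rewrite mulgA mulgV mul1g.
split=> [|v vn]; last by rewrite actM -kg// actK.
by apply: levelM => //; apply: levelV; exact: level_homo kn.
Qed.

Lemma amenable_edge_stab : amenable_on R edge_stab.
Proof.
rewrite (_ : edge_stab = \bigcup_n level n).
  exact: amenable_on_bigcup level_homo amenable_level.
apply/seteqP; split=> [g gE|g [n _ []//]].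
have /finite_seqP[r rE] := sigma_finite g.
exists (\max_(v <- r) depth v).+1 => //; split=> // v; apply: contraLR => vF.
rewrite -leqNgt (big_rem v)/=; first exact: leq_maxl.
by have : [set` r] v by rewrite -rE.
Qed.

End EdgeStabilizer.

(** * Elements supported on opposite half-trees *)

Section OppositeBranches.
Variables (x0 : T) (a0 : Omega) (p : group_of F').
Hypothesis pa0 : val p a0 = a0.
Let y0 := nb x0 a0.
Let g1 := spread y0 p.
Let g2 := spread x0 p.

(** [g1] is spread from [y0] by a permutation fixing [a0], so it fixes the branch at [y0] through
    the edge, which is the complement of [half x0 a0]. *)
Lemma opposite_fix1 x : ~ half x0 a0 x -> act g1 x = x.
Proof.
move=> x0x; apply: spread_branch pa0 _.
by have : half y0 a0 x by rewrite half_compl.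
Qed.

Lemma opposite_fix2 x : half x0 a0 x -> act g2 x = x.
Proof. exact: spread_branch. Qed.

(** Each half-tree is fixed pointwise by one of the elements and, by injectivity, mapped into itself
    by the other. *)
Lemma opposite_commute : (g1 * g2 = g2 * g1)%g.
Proof.
apply: gammaE => x; rewrite !actM.
have [hx|hx] := pselect (half x0 a0 x).
  rewrite opposite_fix2//; apply/esym/opposite_fix2.
  by apply: contrapT => /[dup] h /opposite_fix1/act_inj E; apply: h; rewrite E.
rewrite (opposite_fix1 hx); apply: opposite_fix1 =>
  /[dup] h /opposite_fix2/act_inj E.
by apply: hx; rewrite -E.
Qed.

Lemma half_cross u b : half x0 a0 (nb u b) -> ~ half x0 a0 u ->
  u = x0 /\ b = a0.
Proof.
rewrite /half /= => hw hu; have [ub|ub] :=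
  boolP (reduced (rcons (word x0 u) b)).
  move: hw hu; rewrite word_neighbor//; have := walk_word c x0 u.
  by case: (word x0 u) => [/= <- [->]|d s _ /= ->].
by case: hu; rewrite (word_neighbor_back ub); case: word hw.
Qed.

(** The translate by [k] of the fixed edge lies in one of the two half-trees or is that edge itself,
    so [g1] or [g2] fixes both its ends. *)
Lemma opposite_conj k : edge_stab x0 a0 (k^-1 * g1 * k)%g \/ edge_stab x0 a0
  (k^-1 * g2 * k)%g.
Proof.
pose u := act k x0; pose w := act k y0.
have wE : w = nb u (sigma k x0 a0) by rewrite /w act_neighbor.
have conjI g : act g u = u -> act g w = w -> edge_stab x0 a0 (k^-1 * g * k)%g.
  by move=> gu gw; split; rewrite !actM -/u -/w ?gu ?gw /u /w actK.
have hx0 : ~ half x0 a0 x0 by rewrite /half /= wordxx.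
have g1y : act g1 y0 = y0 by exact: spread_fix.
have [hu|hu] := pselect (half x0 a0 u); have [hw|hw] := pselect (half x0 a0 w).
- by right; apply: conjI; exact: opposite_fix2.
- have [wx ba] : w = x0 /\ sigma k x0 a0 = a0.
    by apply: half_cross hw; rewrite wE neighborK.
  left; apply: conjI; last by apply: opposite_fix1.
  have -> : u = y0 by rewrite /y0 -wx wE ba neighborK.
  exact: g1y.
- have [ux ba] : u = x0 /\ sigma k x0 a0 = a0 by apply: half_cross hu;
  rewrite -wE.
  left; apply: conjI; first exact: opposite_fix1.
  by rewrite wE ux ba g1y.
- by left; apply: conjI; exact: opposite_fix1.
Qed.

End OppositeBranches.

(** An element of [F'] outside [F] is divided by one of [F] with the same value at [a]; the quotient
    is not 1, as the two would then coincide. *)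
Lemma exists_stabilizing a : (exists2 s, s \in F' & s \notin F) ->
  exists2 p : group_of F', val p a = a & val p != 1%g.
Proof.
move=> [s sF' sF]; have [f fF fa] := orbit_rep a sF'.
have pF' : (f^-1 * s)%g \in F' by rewrite gpredM ?gpredVr// FF'.
exists (GroupOf pF'); first by rewrite -[LHS]/(f^-1%g (s a)) -fa symK.
apply: contra sF => /eqP E; have -> : s = f by apply/(mulgI f^-1%g);
  rewrite mulVg.
exact: fF.
Qed.

Lemma spread_neq1 v p : val p != 1%g -> spread v p != 1%g.
Proof. by apply: contra => /eqP E; rewrite -(sigma_spread v p) E sigma1. Qed.

End LocallyPrescribed.

(** * The trivial subgroup, three colours, and the conclusion *)

Lemma amenable_trivial (R : realType) (G : groupType) :
  amenable R (group_of (trivial_subgroup G)).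
Proof.
exists (fun f => f 1%g); split=> // g f _; congr f.
by case: g => g /[dup] /eqP gE g1; apply: val_inj; rewrite /= gE mul1g.
Qed.

Lemma is_normal_trivial (G : groupType) : is_normal (trivial_subgroup G).
Proof. by move=> x y /eqP->; rewrite conj1g inE. Qed.

Lemma card_le_inj (I Omega : Type) :
  ([set: I] #<= [set: Omega])%card -> exists h : I -> Omega, injective h.
Proof.
move=> /card_leP[f]; exists (fun i => set_val (f (to_setT i))) => i j /val_inj.
have f_inj : {in setT &, injective f} by exact: 'inj_f.
by move/f_inj; rewrite !in_setT => /(_ isT isT)/(congr1 set_val).
Qed.

Lemma avoid_two (Omega : eqType) (h : 'I_3 -> Omega) : injective h ->
  forall a b : Omega, exists d, d != a /\ d != b.
Proof.
move=> h_inj a b; apply: contrapT => none.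
have hab i : h i \in [:: a; b].
  by rewrite !inE; apply/negPn/negP; rewrite negb_or => /andP[? ?];
    apply: none; exists (h i).
have : (size (map h (enum 'I_3)) <= size [:: a; b])%N.
  apply: uniq_leq_size; first by rewrite map_inj_uniq ?enum_uniq.
  by move=> _ /mapP[i _ ->].
by rewrite size_map size_enum_ord.
Qed.

Local Open Scope classical_set_scope.
Local Open Scope card_scope.

Theorem theoremC (R : realType) (Omega : choiceType)
    (F F' : groupClosed (sym Omega))
    (T : tree) (c : edge_coloring T Omega) :
  countable [set: Omega] ->
  [set: 'I_3] #<= [set: Omega] ->
  countable [set` F] ->
  countable [set` F'] ->
  [set` F] `<` [set` F'] ->
  acts_freely F ->
  preserves_orbits F F' ->
  (forall a : Omega, amenable R (group_of (stabilizer F' a))) ->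
  regular_of_degree T Omega ->
  [/\ countable [set: group_of (GFF c F F')],
      has_trivial_amenable_radical R (group_of (GFF c F F'))
    & ~ Cstar_simple R (group_of (GFF c F F'))].
Proof.
move=> Omega_c /card_le_inj[h h_inj] _ F'_c [FsubF' F'F] Ffree Forb Fam _.
have FF' : {subset F <= F'} by move=> s; exact: FsubF'.
have Gc := countable_gamma c Ffree Omega_c F'_c.
split=> //.
- split; [exact: is_normal_trivial|exact: amenable_trivial|].
  exact: amenable_normal_trivial (avoid_two h_inj).
- have [x0] := tree_inhabited T; pose a0 := h ord0.
  have /countable_injP[e e_inj] := countable_vertices c Omega_c.
  have {}e_inj : injective e by move=> v w; apply: e_inj; rewrite inE.
  (* Strictness of the inclusion gives an element of [F'] outside [F], hence a non-trivial
     permutation in [F'] fixing [a0]. *)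
  have [|p pa p1] := exists_stabilizing FF' Forb a0.
    apply: contrapT => none; apply: F'F => s sF'; apply: contrapT => /negP sF.
    by apply: none; exists s.
  have Aam := amenable_edge_stab c FF' Ffree Forb x0 a0 e_inj Fam.
  apply: (not_Cstar_simple _ Gc Aam (spread_neq1 c FF' Forb (neighbor c x0 a0)
    p1)
    (spread_neq1 c FF' Forb x0 p1)).
  - move=> g k gE; split; last by move=> kE;
    exact: edge_stabM (edge_stabV gE) kE.
    by move=> /(edge_stabM gE); rewrite mulgA mulgV mul1g.
  - exact: opposite_commute.
  - exact: opposite_conj.
Qed.
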